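(* Let $C$ be a nonempty bounded closed and convex subset of a uniformly nonsquare Banach space. Then every asymptotically nonexpansive in the intermediate sense mapping $T:C\to C$ has a fixed point.
   Context: A Banach space $X$ with unit sphere $S_X$ is uniformly nonsquare if $\sup_{x,y\in S_X}\min\{\|x+y\|,\|x-y\|\}<2$. A mapping $T:C\to C$ is asymptotically nonexpansive in the intermediate sense if $T$ is continuous and $\limsup_{n\to\infty}\sup_{x,y\in C}(\|T^nx-T^ny\|-\|x-y\|)\le 0$. *)

(* Defs.v *)
From HB Require Import structures.
From mathcomp Require Import all_boot all_order all_algebra.
From mathcomp Require Import all_classical all_reals all_analysis.

Set Implicit Arguments.
Unset Strict Implicit.
Unset Printing Implicit Defensive.

Import Order.TTheory GRing.Theory Num.Theory.
Import numFieldNormedType.Exports.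

Local Open Scope classical_set_scope.
Local Open Scope ring_scope.

Definition unit_sphere (R : realType) (X : normedModType R) : set X :=
  [set x | `|x| = 1].

(* The supremum is taken in \bar R, so that it is -oo, and the condition holds,
   for the zero space, whose unit sphere is empty. *)
Definition uniformly_nonsquare (R : realType) (X : normedModType R) : Prop :=
  (ereal_sup [set (Num.min `|x + y| `|x - y|)%:E
             | x in @unit_sphere R X & y in @unit_sphere R X] < 2%:E)%E.

(* T is a self-map of C given by a total function on X, whose values outside C
   are irrelevant: continuity is for the subspace topology of C, and iterates
   are only taken from points of C. *)
Definition asymptotically_nonexpansive_intermediate
    (R : realType) (X : normedModType R) (C : set X) (T : X -> X) : Prop :=
  [/\ set_fun C C T,
      {within C, continuous T} &
      (limn_esup (fun n : nat =>
         ereal_sup [set (`|iter n T x - iter n T y| - `|x - y|)%:E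
                   | x in C & y in C]) <= 0)%E].

(* Main.v *)
Require Import Defs.
From HB Require Import structures.
From mathcomp Require Import all_boot all_order all_algebra.
From mathcomp Require Import all_classical all_reals all_analysis.
From mathcomp Require Import ring lra.
Import Order.TTheory GRing.Theory Num.Theory.
Import numFieldNormedType.Exports.
Local Open Scope classical_set_scope.
Local Open Scope ring_scope.

(** The von Neumann-Jordan inequality
    |x + y|^2 + |x - y|^2 <= 2c (|x|^2 + |y|^2) with c < 2 characterizes uniform
    nonsquareness and passes to ultrapowers and to finite l2-sums. On the
    ultrapower of X, the maps [w_n] |-> [T^(s n) w_n], for s tending to
    infinity, commute and are honestly nonexpansive. A common fixed point of
    all of them has components w_n that T^k almost fixes for all large k
    simultaneously; keeping w_n close to an already given almost fixed point,
    one gets a Cauchy sequence whose limit x satisfies T^k x --> x, so T x = x.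

    Common fixed points in spaces satisfying the inequality are obtained
    without weak compactness. Let r be the supremum of the numbers for which,
    in some invariant set K, almost fixed points asymptotically stay that far from
    every given point of K. If r = 0, invariant sets can be shrunk to a point.
    If r > 0, one builds a finite chain q_1, q_2, ... of better and better
    almost fixed points with mutual distances about r. By James's theorem some
    early convex combination y of the chain is close to a late one, sum b_i q_i.
    Starting from the midpoints of y and q_i, one finds almost fixed points w_i,
    better than what y can see, with |w_i - w_l| and |w_i - q_i| at most about
    r/2 and |w_i - y| at least about r, against c < 2 (this is the argument of
    Maurey and Lin, as used for nonsquare spaces by Garcia-Falset,
    Llorens-Fuster and Mazcunan-Navarro).

    Almost fixed points of k + 1 commuting maps are found by running the
    Goebel-Kirk iteration of the last map inside the common fixed point set of
    the first k, hence an induction on k. *)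

Set Implicit Arguments.
Unset Strict Implicit.
Unset Printing Implicit Defensive.

(** * Limits along a free ultrafilter *)

Definition free_ultra : set_system nat :=
  projT1 (cid (ultraFilterLemma eventually_filter)).
Local Notation U := free_ultra.

#[local] Instance U_ultra : UltraFilter U.
Proof. by have [] := projT2 (cid (ultraFilterLemma eventually_filter)). Qed.

Lemma U_ge N : U [set n | (N <= n)%N].
Proof.
have [_ h] := projT2 (cid (ultraFilterLemma eventually_filter)).
by apply: h; exists N.
Qed.

Lemma U_mono (P Q : set nat) : (forall n, P n -> Q n) -> U P -> U Q.
Proof. exact: filterS. Qed.

Lemma U_and (P Q : set nat) : U P -> U Q -> U (fun n => P n /\ Q n).
Proof. exact: filterI. Qed.

Lemma U_all (P : set nat) : (forall n, P n) -> U P.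
Proof. by move=> h; apply: filterS filterT. Qed.

Lemma U_ex (P : set nat) : U P -> exists n, P n.
Proof. exact: filter_ex. Qed.

Lemma U_dec (P : set nat) : ~ U P -> U (fun n => ~ P n).
Proof. by have [//|] := in_ultra_setVsetC P U_ultra. Qed.

Section ulim.
Variable R : realType.
Implicit Types a b : nat -> R.

Definition ubounded a := exists M, forall n, `|a n| <= M.
Definition ulim a : R := lim (a @ U).

Lemma ulim_cvg a : ubounded a -> a @ U --> ulim a.
Proof.
move=> [M hM].
have [] := @segment_compact R (- M) M (a @ U) _ _.
  by apply: U_all => n /=; rewrite in_itv /= -ler_norml.
move=> l [_ al]; apply: (@cvgP _ _ l) => N nN; apply: contrapT => /U_dec h.
by have [x [hx]] := al (~` N) N h nN.
Qed.

Lemma ulim_lt a e : ubounded a -> ulim a < e -> U (fun n => a n < e).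
Proof. by move=> /ulim_cvg ca h; apply: (cvgr_lt _ ca). Qed.

Lemma ulim_le a e : ubounded a -> U (fun n => a n <= e) -> ulim a <= e.
Proof. by move=> /ulim_cvg ca h; apply: (cvgr_to_le ca). Qed.

Lemma ulim_ge a e : ubounded a -> U (fun n => e <= a n) -> e <= ulim a.
Proof. by move=> /ulim_cvg ca h; apply: (cvgr_to_ge ca). Qed.

Lemma ulim_cst (r : R) : ulim (fun=> r) = r.
Proof. exact: lim_cst. Qed.

Lemma ubounded_cst (r : R) : ubounded (fun=> r).
Proof. by exists `|r|. Qed.

Lemma uboundedD a b : ubounded a -> ubounded b -> ubounded (fun n => a n + b n).
Proof.
move=> [M hM] [N hN]; exists (M + N) => n.
by rewrite (le_trans (ler_normD _ _))// lerD.
Qed.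

Lemma uboundedM a b : ubounded a -> ubounded b -> ubounded (fun n => a n * b n).
Proof.
move=> [M hM] [N hN]; exists (M * N) => n.
by rewrite normrM ler_pM.
Qed.

Lemma ulimD a b : ubounded a -> ubounded b ->
  ulim (fun n => a n + b n) = ulim a + ulim b.
Proof.
by move=> /ulim_cvg ca /ulim_cvg cb; apply/cvg_lim => //; apply: cvgD.
Qed.

Lemma ulimM a b : ubounded a -> ubounded b ->
  ulim (fun n => a n * b n) = ulim a * ulim b.
Proof.
by move=> /ulim_cvg ca /ulim_cvg cb; apply/cvg_lim => //; apply: cvgM.
Qed.

Lemma ulim_mono a b : ubounded a -> ubounded b ->
  (forall n, a n <= b n) -> ulim a <= ulim b.
Proof.
move=> ba bb ab; apply: ler_lim => //.
- exact/cvgP/ulim_cvg.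
- exact/cvgP/ulim_cvg.
- exact: U_all.
Qed.
End ulim.

(** * Seminormed spaces with the nonsquare inequality *)

Section njspace.
Variables (R : realType) (c : R).

(** A seminorm rather than a norm: ultrapowers are then plain spaces of bounded sequences and no
    quotient is formed. The constant [c] is fixed outside, because ultrapowers and finite l2-sums
    keep it. *)
Structure njSpace := NJSpace {
  nj_lmod :> lmodType R;
  nrm : nj_lmod -> R;
  nrmD : forall x y, nrm (x + y) <= nrm x + nrm y;
  nrmZ : forall a x, nrm (a *: x) = `|a| * nrm x;
  nrm_nj : forall x y, nrm (x + y) ^+ 2 + nrm (x - y) ^+ 2 <=
                  2 * c * (nrm x ^+ 2 + nrm y ^+ 2) }.

Section theory.
Variable V : njSpace.
Implicit Types (x y z : V) (a t : R).

Lemma nrm0 : nrm (0 : V) = 0.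
Proof. by rewrite -(scale0r (0 : V)) nrmZ normr0 mul0r. Qed.

Lemma nrmN x : nrm (- x) = nrm x.
Proof. by rewrite -scaleN1r nrmZ normrN normr1 mul1r. Qed.

Lemma nrm_ge0 x : 0 <= nrm x.
Proof. have := nrmD x (- x); rewrite subrr nrm0 nrmN; lra. Qed.

Lemma nrmB x y : nrm (x - y) <= nrm x + nrm y.
Proof. by rewrite -(nrmN y) nrmD. Qed.

Lemma nrmC x y : nrm (x - y) = nrm (y - x).
Proof. by rewrite -nrmN opprB. Qed.

Lemma nrm_tri z x y : nrm (x - y) <= nrm (x - z) + nrm (z - y).
Proof. by rewrite -{1}(subrK z x) -addrA nrmD. Qed.

Lemma nrm_conv t x y : 0 <= t <= 1 ->
  nrm (t *: x + (1 - t) *: y) <= t * nrm x + (1 - t) * nrm y.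
Proof.
move=> /andP[t0 t1]; rewrite (le_trans (nrmD _ _))// !nrmZ.
by rewrite !ger0_norm ?subr_ge0.
Qed.

Lemma nrm_convB t x y z : 0 <= t <= 1 ->
  nrm (t *: x + (1 - t) *: y - z) <= t * nrm (x - z) + (1 - t) * nrm (y - z).
Proof.
move=> t01; apply: le_trans (nrm_conv _ _ t01); rewrite !scalerBr addrACA -opprD.
by rewrite -scalerDl addrC [t + _]addrC subrK scale1r addrC.
Qed.

End theory.

(** * Ultrapowers *)

Section upow.
Variable V : njSpace.

Definition ubdd : {pred nat -> V} :=
  fun w => `[< exists M, forall n, nrm (w n) <= M >].

Lemma ubdd_submod : submod_closed ubdd.
Proof.
split; first by apply/asboolP; exists 0 => n; rewrite nrm0.
move=> a x y /asboolP[M hM] /asboolP[N hN]; apply/asboolP.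
exists (`|a| * M + N) => n.
by rewrite (le_trans (nrmD _ _))// nrmZ lerD// ler_wpM2l.
Qed.

HB.instance Definition _ := GRing.isSubmodClosed.Build R (nat -> V) ubdd
  ubdd_submod.

Record upow_type := UPow { uval :> nat -> V; _ : uval \in ubdd }.

HB.instance Definition _ := [isSub for uval].
HB.instance Definition _ := [Choice of upow_type by <:].
HB.instance Definition _ := [SubChoice_isSubLmodule of upow_type by <:].

Implicit Types (w : upow_type).

Lemma uvalP w : ubounded (fun n => nrm (w n)).
Proof.
by case: w => w /= /asboolP[M hM]; exists M => n; rewrite ger0_norm ?nrm_ge0.
Qed.

Definition unrm w : R := ulim (fun n => nrm (w n)).

Lemma uvalD w w' n : (w + w') n = w n + w' n. Proof. by []. Qed.
Lemma uvalZ a w n : (a *: w) n = a *: w n. Proof. by []. Qed.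
Lemma uvalN w n : (- w) n = - w n. Proof. by []. Qed.

Lemma unrmD w w' : unrm (w + w') <= unrm w + unrm w'.
Proof.
rewrite -ulimD; [|exact: uvalP..]; apply: ulim_mono => [|| n].
- exact: (uvalP (w + w')).
- by apply: uboundedD; exact: uvalP.
- exact: nrmD.
Qed.

Lemma unrmZ a w : unrm (a *: w) = `|a| * unrm w.
Proof.
rewrite -[X in X * _](ulim_cst `|a|) -ulimM.
- by congr ulim; apply/funext => n; rewrite uvalZ nrmZ.
- exact: ubounded_cst.
- exact: uvalP.
Qed.

Lemma unrm_nj w w' : unrm (w + w') ^+ 2 + unrm (w - w') ^+ 2 <=
   2 * c * (unrm w ^+ 2 + unrm w' ^+ 2).
Proof.
have b := uvalP; have bb (v : upow_type) : ubounded (fun n => nrm (v n) * nrm (v n)).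
  by apply: uboundedM; exact: b.
rewrite -[2 * c](ulim_cst (2 * c)) !expr2 -!ulimM// -!ulimD// -ulimM//.
- apply: ulim_mono.
  + exact: uboundedD.
  + by apply: uboundedM; [exact: ubounded_cst|exact: uboundedD].
  + by move=> n; have := nrm_nj (w n) (w' n); rewrite !expr2.
- exact: ubounded_cst.
- exact: uboundedD.
Qed.

Definition upow := NJSpace unrmD unrmZ unrm_nj.

(* Junk value: [mkU w] is [0] when [w] is unbounded. *)
Definition mkU (w : nat -> V) : upow := insubd 0 w.

Lemma mkUE (w : nat -> V) M n : (forall n, nrm (w n) <= M) -> uval (mkU w) n = w n.
Proof.
by move=> h; rewrite /mkU val_insubd ifT//; apply/asboolP; exists M.
Qed.

Lemma unrm_lt (w : upow) e : nrm w < e -> U (fun n => nrm (w n) < e).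
Proof. by apply: ulim_lt; exact: uvalP. Qed.

Lemma unrm_le (w : upow) e : U (fun n => nrm (w n) <= e) -> nrm w <= e.
Proof. by apply: ulim_le; exact: uvalP. Qed.

End upow.
End njspace.

Lemma archi_inv (R : realType) (e : R) : 0 < e -> exists n : nat, n.+1%:R^-1 < e.
Proof.
move=> e0; exists (Num.bound e^-1); rewrite invf_plt ?posrE//.
rewrite (lt_le_trans (archi_boundP _)) ?invr_ge0 ?(ltW e0)//.
by rewrite ler_nat.
Qed.

Section complete.
Variables (R : realType) (c : R) (V : njSpace c).

Definition ncvg (u : nat -> V) (x : V) :=
  forall e, 0 < e -> exists N, forall n, (N <= n)%N -> nrm (u n - x) <= e.

Definition ncauchy (u : nat -> V) := forall e, 0 < e ->
  exists N, forall m n, (N <= m)%N -> (N <= n)%N -> nrm (u m - u n) <= e.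

(** Limits for a seminorm are not unique; asking for one limit inside [K] merges completeness with
    closedness. *)
Definition complete_in (K : set V) := forall u, (forall n, K (u n)) ->
  ncauchy u -> exists2 x, K x & ncvg u x.

Definition convex_in (K : set V) := forall t x y, 0 <= t <= 1 ->
  K x -> K y -> K (t *: x + (1 - t) *: y).

Lemma ncvg_le (u : nat -> V) x z r : ncvg u x ->
  (forall n, nrm (u n - z) <= r) -> nrm (x - z) <= r.
Proof.
move=> ux h; apply/ler_addgt0Pr => e e0; have [N hN] := ux _ e0.
rewrite (le_trans (nrm_tri (u N) _ _))// addrC lerD//.
by rewrite nrmC hN.
Qed.

End complete.

(** * Completeness of ultrapowers *)

Section upow_complete.
Variables (R : realType) (c : R) (V : njSpace c).

Lemma U_forall_lt (P : nat -> set nat) J :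
  (forall j, (j < J)%N -> U (P j)) -> U (fun n => forall j, (j < J)%N -> P j n).
Proof.
elim: J => [|J IH] h; first exact: U_all.
have := U_and (IH (fun j jJ => h j (ltnW jJ))) (h J (ltnSn J)).
apply: U_mono => n [h1 h2] j; rewrite ltnS leq_eqVlt => /orP[/eqP->//|].
exact: h1.
Qed.

(** A diagonal sequence is a limit. Each of its coordinates is a coordinate of some [w j], so
    coordinatewise conditions such as membership in a fixed set pass to the limit. *)
Lemma upow_complete (w : nat -> upow V) M :
  (forall j n, nrm (w j n) <= M) -> ncauchy w ->
  exists2 x : upow V, (forall n, exists j, x n = w j n) & ncvg w x.
Proof.
move=> wM wc.
(* At coordinate [n], the terms up to index [J] have distances at most slightly above those in the
   ultrapower. The clause [J <= n] bounds such [J], so that the diagonal can use the largest one. *)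
pose E J n := (J <= n)%N /\ forall i, (i < J.+1)%N -> forall k, (k < J.+1)%N ->
  nrm (w i n - w k n) <= nrm (w i - w k) + J.+1%:R^-1.
have UE J : U (E J).
  apply: U_and; first exact: U_ge.
  apply: U_forall_lt => i _; apply: U_forall_lt => k _.
  have := @unrm_lt _ _ _ (w i - w k) (nrm (w i - w k) + J.+1%:R^-1).
  by rewrite ltrDl invr_gt0 ltr0Sn => /(_ isT); apply: U_mono => n /ltW.
have Ex n : exists j, forall J, E J n -> (J <= j)%N /\ E j n.
  have [[J0 h0]|h] := pselect (exists J, E J n); last first.
    by exists 0%N => J hJ; case: h; exists J.
  have ex : exists J, `[< E J n >] by exists J0; apply/asboolP.
  have bd J : `[< E J n >] -> (J <= n)%N by move=> /asboolP[].
  case: (ex_maxnP ex bd) => j /asboolP Ej jmax; exists j => J EJ; split => //.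
  by apply: jmax; apply/asboolP.
have [j hj] := choice Ex.
pose x := mkU (fun n => w (j n) n).
have xE n : x n = w (j n) n by apply: (mkUE (M := M)) => k; exact: wM.
exists x => [n|e e0]; first by exists (j n).
have e20 : 0 < e / 2 by rewrite divr_gt0.
have [N hN] := wc _ e20; have [K hK] := archi_inv e20.
exists N => i Ni; apply: unrm_le.
apply: U_mono (UE (maxn i K)) => n /hj[+ [_ h]]; rewrite geq_max => /andP[ij Kj].
rewrite uvalD uvalN xE (le_trans (h i _ (j n) _)) ?ltnS// (splitr e) lerD//.
  by apply: hN => //; exact: leq_trans ij.
by rewrite (le_trans _ (ltW hK))// lef_pV2 ?posrE// ler_nat.
Qed.

End upow_complete.

(** * Finite l2-sums *)

Section tuples.
Variables (R : realType) (c : R) (V : njSpace c) (m : nat).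

Let s0 (h : 'I_m -> R) : 0 <= \sum_i h i ^+ 2.
Proof. by apply: sumr_ge0 => i _; rewrite sqr_ge0. Qed.

Lemma cauchy_schwarz (f g : 'I_m -> R) :
  \sum_i f i * g i <=
  Num.sqrt (\sum_i f i ^+ 2) * Num.sqrt (\sum_i g i ^+ 2).
Proof.
have z (h k : 'I_m -> R) : Num.sqrt (\sum_i h i ^+ 2) = 0 -> \sum_i h i * k i = 0.
  move/eqP; rewrite sqrtr_eq0 => h0; apply: big1 => i _.
  have /eqP : \sum_i h i ^+ 2 = 0 by apply/le_anti; rewrite h0 s0.
  rewrite psumr_eq0 => [/allP/(_ i)|j _]; last by rewrite sqr_ge0.
  by rewrite mem_index_enum sqrf_eq0 => /(_ isT)/eqP->; rewrite mul0r.
set F := Num.sqrt _; set G := Num.sqrt _.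
have [F0|F0] := eqVneq F 0; first by rewrite z// F0 mul0r.
have [G0|G0] := eqVneq G 0.
  by under eq_bigr do rewrite mulrC; rewrite z// G0 mulr0.
have Fp : 0 < F by rewrite lt_neqAle eq_sym F0 sqrtr_ge0.
have Gp : 0 < G by rewrite lt_neqAle eq_sym G0 sqrtr_ge0.
rewrite -(ler_pM2l (mulr_gt0 Fp Gp)).
have F2 : F ^+ 2 = \sum_i f i ^+ 2 by rewrite sqr_sqrtr.
have G2 : G ^+ 2 = \sum_i g i ^+ 2 by rewrite sqr_sqrtr.
have -> : F * G * (F * G) =
   \sum_i (2^-1 * G ^+ 2 * f i ^+ 2 + 2^-1 * F ^+ 2 * g i ^+ 2).
  by rewrite big_split/= -!mulr_sumr -F2 -G2; field.
rewrite mulr_sumr; apply: ler_sum => i _.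
have := sqr_ge0 (G * f i - F * g i); nra.
Qed.

Lemma minkowski (f g : 'I_m -> R) :
  Num.sqrt (\sum_i (f i + g i) ^+ 2) <=
  Num.sqrt (\sum_i f i ^+ 2) + Num.sqrt (\sum_i g i ^+ 2).
Proof.
rewrite -(@ler_pXn2r _ 2) ?nnegrE ?addr_ge0 ?sqrtr_ge0//.
rewrite sqr_sqrtr// sqrrD !sqr_sqrtr//.
have -> : \sum_i (f i + g i) ^+ 2 =
   \sum_i f i ^+ 2 + (\sum_i f i * g i) *+ 2 + \sum_i g i ^+ 2.
  by rewrite -sumrMnl -!big_split; apply: eq_bigr => i _; rewrite sqrrD.
by rewrite lerD2r lerD2l lerMn2r cauchy_schwarz.
Qed.

Definition tnrm (x : {ffun 'I_m -> V}) : R := Num.sqrt (\sum_i nrm (x i) ^+ 2).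

Lemma tnrmD x y : tnrm (x + y) <= tnrm x + tnrm y.
Proof.
apply: le_trans (minkowski _ _); apply: ler_wsqrtr; apply: ler_sum => i _.
by rewrite ffunE ler_sqr ?nnegrE ?addr_ge0 ?nrm_ge0// nrmD.
Qed.

Lemma tnrmZ a x : tnrm (a *: x) = `|a| * tnrm x.
Proof.
rewrite /tnrm -sqrtr_sqr -sqrtrM ?sqr_ge0// mulr_sumr.
congr Num.sqrt; apply: eq_bigr => i _.
by rewrite ffunE nrmZ exprMn real_normK ?num_real.
Qed.

Lemma tnrm_nj x y : tnrm (x + y) ^+ 2 + tnrm (x - y) ^+ 2 <=
   2 * c * (tnrm x ^+ 2 + tnrm y ^+ 2).
Proof.
rewrite /tnrm !sqr_sqrtr// -!big_split mulr_sumr; apply: ler_sum => i _.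
by rewrite !ffunE; exact: nrm_nj.
Qed.

Definition tup : njSpace c := NJSpace tnrmD tnrmZ tnrm_nj.

Lemma nrm_tup_ge (x : tup) i : nrm (x i) <= nrm x.
Proof.
rewrite -(ler_sqr (nrm_ge0 _) (nrm_ge0 _)) [leRHS]sqr_sqrtr// (bigD1 i)//= lerDl.
by apply: sumr_ge0 => j _; rewrite sqr_ge0.
Qed.

Lemma nrm_tup_le (x y : tup) : (forall i, nrm (x i) <= nrm (y i)) ->
  nrm x <= nrm y.
Proof.
move=> h; apply: ler_wsqrtr; apply: ler_sum => i _.
by rewrite ler_sqr ?nnegrE ?nrm_ge0.
Qed.

Lemma nrm_tup_bound (x : tup) M : (forall i, nrm (x i) <= M) ->
  nrm x <= Num.sqrt (\sum_(i < m) M ^+ 2).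
Proof.
move=> h; apply: ler_wsqrtr; apply: ler_sum => i _.
by rewrite ler_sqr ?nnegrE ?nrm_ge0// (le_trans _ (h i))// nrm_ge0.
Qed.

End tuples.

(** * James's theorem *)

Section lists.
Variable R : pzRingType.
Implicit Types (s t u v : seq R) (a b : R).
Definition addl s t := [seq p.1 + p.2 | p <- zip s t].
Definition subl s t := [seq p.1 - p.2 | p <- zip s t].
Definition scale a s := [seq a * b | b <- s].

Lemma addl_cat s1 s2 t1 t2 : size s1 = size t1 ->
  addl (s1 ++ s2) (t1 ++ t2) = addl s1 t1 ++ addl s2 t2.
Proof. by move=> h; rewrite /addl zip_cat// map_cat. Qed.

Lemma subl_cat s1 s2 t1 t2 : size s1 = size t1 ->
  subl (s1 ++ s2) (t1 ++ t2) = subl s1 t1 ++ subl s2 t2.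
Proof. by move=> h; rewrite /subl zip_cat// map_cat. Qed.

Lemma scale_cat a s t : scale a (s ++ t) = scale a s ++ scale a t.
Proof. exact: map_cat. Qed.

Lemma scaleA a b s : scale a (scale b s) = scale (a * b) s.
Proof. by rewrite /scale -map_comp; apply: eq_map => x /=; rewrite mulrA. Qed.

Lemma addl_scale a b s : addl (scale a s) (scale b s) = scale (a + b) s.
Proof. by elim: s => //= x s IH; rewrite /addl /= mulrDl; congr cons. Qed.

Lemma subl_scale a b s : subl (scale a s) (scale b s) = scale (a - b) s.
Proof. by elim: s => //= x s IH; rewrite /subl /= mulrBl; congr cons. Qed.

Lemma scale0 s : scale 0 s = nseq (size s) 0.
Proof. by elim: s => //= x s ->; rewrite mul0r. Qed.

Lemma scale_nseq0 a n : scale a (nseq n 0) = nseq n 0.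
Proof. by rewrite /scale map_nseq mulr0. Qed.
End lists.

Section weights.
Variable R : realType.

Definition wts (a : nat -> R) n := (forall i, 0 <= a i) /\ \sum_(i < n) a i = 1.

Definition block (u : seq R) := all (fun a => 0 <= a) u /\ \sum_(a <- u) a = 1.

Lemma block0l u n : block u -> block (nseq n 0 ++ u).
Proof.
move=> [h s]; split; last by rewrite big_cat/= big1_seq ?add0r// => i /andP[_ /nseqP[]].
by rewrite all_cat h andbT; apply/allP => i /nseqP[->].
Qed.

Lemma block0r u n : block u -> block (u ++ nseq n 0).
Proof.
move=> [h s]; split.
  by rewrite all_cat h /=; apply/allP => i /nseqP[->].
by rewrite big_cat/= [X in _ + X]big1_seq ?addr0// => i /andP[_ /nseqP[]].
Qed.

Lemma block_mid u v : block u -> block v -> block (scale 2^-1 (u ++ v)).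
Proof.
move=> [hu su] [hv sv]; split.
  apply/allP => _ /mapP[b + ->]; rewrite mem_cat => h; rewrite mulr_ge0 ?invr_ge0//.
  by case/orP: h => [/(allP hu)|/(allP hv)].
by rewrite big_map -mulr_sumr big_cat/= su sv; field.
Qed.

Lemma weights_of_block (V : lmodType R) (x : nat -> V) (u : seq R) (ns : seq nat)
    j n : block u -> size ns = size u -> all (fun k => j <= k < j + n)%N ns ->
  exists a, wts a n /\
   \sum_(p <- zip u ns) p.1 *: x p.2 = \sum_(i < n) a i *: x (j + i)%N.
Proof.
move=> [u0 u1] sz /allP nsj.
(* Indices may repeat in [ns], so the weights met at one index are added up. *)
pose a i := \sum_(p <- zip u ns | p.2 == (j + i)%N) p.1.
have hp p : p \in zip u ns -> (0 <= p.1) && (j <= p.2 < j + n)%N.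
  case: p => p1 p2 /= h.
  have h1 : p1 \in unzip1 (zip u ns) by apply/mapP; exists (p1, p2).
  have h2 : p2 \in unzip2 (zip u ns) by apply/mapP; exists (p1, p2).
  rewrite unzip1_zip ?sz// in h1; rewrite unzip2_zip ?sz// in h2.
  by rewrite (allP u0)//= nsj.
(* Kept general in the module: for the constant 1 in [R^o], the same regrouping shows that the new
   weights sum to 1. *)
have re (W : lmodType R) (f : nat -> W) :
    \sum_(i < n) a i *: f (j + i)%N = \sum_(p <- zip u ns) p.1 *: f p.2.
  rewrite /a; under eq_bigr do rewrite scaler_suml.
  transitivity (\sum_(i < n) \sum_(p <- zip u ns | p.2 == (j + i)%N) p.1 *: f p.2).
    by apply: eq_bigr => i _; apply: eq_bigr => p /eqP ->.
  rewrite (exchange_big_dep predT)//=; apply: eq_big_seq => p /hp/andP[_ /andP[jp pn]].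
  have pj : (p.2 - j < n)%N by rewrite ltn_subLR.
  rewrite (big_pred1 (Ordinal pj)) ?subnKC// => i /=.
  by rewrite -val_eqE/= eq_sym -(eqn_add2l j i) subnKC.
exists a; split; last by rewrite re.
split.
  by move=> i; rewrite /a big_seq_cond sumr_ge0// => p /andP[/hp/andP[]].
have scl (r : R) : r *: (1 : R^o) = r := mulr1 r.
transitivity (\sum_(i < n) a i *: (1 : R^o)).
  by apply: eq_bigr => i _; rewrite scl.
rewrite (re _ (fun=> 1)) -[RHS]u1.
transitivity (\sum_(p <- zip u ns) p.1).
  by apply: eq_bigr => i _; rewrite scl.
by rewrite -(big_map fst xpredT id) -/(unzip1 _) unzip1_zip// sz.
Qed.

End weights.

(** * Spreading model of a bounded sequence and growth of zigzag norms *)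

Section spreading.
Variables (R : realType) (c : R) (V : njSpace c).
Variables (x : nat -> V) (M : R).
Hypothesis xM : forall i, nrm (x i) <= M.

(* The norm of [z + \sum_i s_i x_(n_i)] for indices n_0 << n_1 << ...: inserting
   zeros in [s] does not change it. *)
Fixpoint sp (z : V) (s : seq R) : R :=
  if s is a :: s' then ulim (fun n => sp (z + a *: x n) s') else nrm z.

Let M0 : 0 <= M. Proof. exact: le_trans (nrm_ge0 _) (xM 0). Qed.

Definition l1 (s : seq R) := \sum_(a <- s) `|a|.

Lemma sp_bounds z s : 0 <= sp z s <= nrm z + M * l1 s.
Proof.
elim: s z => [|a s IH] z /=.
  by rewrite nrm_ge0 /l1 big_nil mulr0 addr0 lexx.
have b n : sp (z + a *: x n) s <= nrm z + M * l1 (a :: s).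
  have /andP[_ h] := IH (z + a *: x n).
  rewrite (le_trans h)// /l1 big_cons mulrDr addrA lerD2r.
  rewrite (le_trans (nrmD _ _))// lerD2l nrmZ mulrC.
  by rewrite ler_wpM2r.
have ub : ubounded (fun n => sp (z + a *: x n) s).
  exists (nrm z + M * l1 (a :: s)) => n; rewrite ger0_norm//.
  by have /andP[] := IH (z + a *: x n).
apply/andP; split.
  by apply: ulim_ge => //; apply: U_all => n; have /andP[] := IH (z + a *: x n).
by apply: ulim_le => //; exact: U_all.
Qed.

Lemma sp_ge0 z s : 0 <= sp z s.
Proof. by have /andP[] := sp_bounds z s. Qed.

Lemma sp_ub z a s : ubounded (fun n => sp (z + a *: x n) s).
Proof.
exists (nrm z + `|a| * M + M * l1 s) => n.
rewrite ger0_norm ?sp_ge0//; have /andP[_ h] := sp_bounds (z + a *: x n) s.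
rewrite (le_trans h)// lerD2r (le_trans (nrmD _ _))// lerD2l nrmZ.
by rewrite ler_wpM2l.
Qed.

Lemma sp_cat z u s t : (forall z, sp z s = sp z t) -> sp z (u ++ s) = sp z (u ++ t).
Proof.
move=> h; elim: u z => [|a u IH] z //=.
by congr ulim; apply/funext => n.
Qed.

Lemma sp_zeros z n s : sp z (nseq n 0 ++ s) = sp z s.
Proof.
elim: n => //= n IH; under [X in ulim X]funext do rewrite scale0r addr0.
by rewrite ulim_cst.
Qed.

(** This is [nrm_nj] for z + w and z - w, whose sum and difference are 2 z and 2 w. It survives the
    nested limits because all four lists are evaluated along the same indices. *)
Lemma sp_nj z w s t : size s = size t -> sp z s ^+ 2 + sp w t ^+ 2 <=
  c / 2 * (sp (z + w) (addl s t) ^+ 2 + sp (z - w) (subl s t) ^+ 2).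
Proof.
elim: s t z w => [|a s IH] [|b t] z w //=.
  move=> _; have := nrm_nj (z + w) (z - w).
  have -> : z + w + (z - w) = 2%:R *: z.
    by rewrite addrACA subrr addr0 scaler_nat.
  have -> : z + w - (z - w) = 2%:R *: w.
    by rewrite opprB [z + w]addrC addrACA subrr addr0 scaler_nat.
  rewrite !nrmZ normr_nat.
  set A := nrm (z + w); set B := nrm (z - w); nra.
move=> [] /IH {}IH.
have e1 n : z + w + (a + b) *: x n = (z + a *: x n) + (w + b *: x n).
  by rewrite scalerDl addrACA.
have e2 n : z - w + (a - b) *: x n = (z + a *: x n) - (w + b *: x n).
  by rewrite scalerBl opprD addrACA.
rewrite -(ulim_cst (c / 2)) !expr2.
have ub := sp_ub; have ub2 z1 a1 s1 : ubounded
    (fun n => sp (z1 + a1 *: x n) s1 * sp (z1 + a1 *: x n) s1).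
  by apply: uboundedM; exact: ub.
rewrite -!ulimM//; [|exact: ub..].
rewrite -!ulimD//; [|exact: ub2..].
rewrite -ulimM//; [|exact: ubounded_cst|by apply: uboundedD; exact: ub2].
apply: ulim_mono => [||n].
- by apply: uboundedD; exact: ub2.
- apply: uboundedM; first exact: ubounded_cst.
  by apply: uboundedD; exact: ub2.
- by have := IH (z + a *: x n) (w + b *: x n); rewrite !expr2 -e1 -e2.
Qed.

(** In each nested limit almost every index exceeds the one chosen before, so only increasing index
    lists matter. *)
Lemma sp_lower th z s n0 :
  (forall ns, path ltn n0 ns -> size ns = size s ->
     th <= nrm (z + \sum_(p <- zip s ns) p.1 *: x p.2)) -> th <= sp z s.
Proof.
elim: s z n0 => [|a s IH] z n0 h /=.
  by have := h [::] isT erefl; rewrite big_nil addr0.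
apply: ulim_ge; first exact: sp_ub.
apply: U_mono (U_ge n0.+1) => n n0n; apply: (IH _ n) => ns pn sz.
have := h (n :: ns); rewrite /= pn sz n0n => /(_ isT erefl).
by rewrite big_cons addrA.
Qed.

(* [zig n] consists of the alternating sums - u_0 + 2 u_1 - 2 u_2 ... +- u_(n+1)
   of consecutive convex blocks, up to a global sign. Doubling the inner blocks
   of [s] as (u, 0) or as (0, u) preserves its norm; the half sum of the two
   results lies in [zig n.+1] and their half difference in [zig n]. Hence the
   infimum of the norm over [zig n] grows exponentially with [n], while it is
   at most linear. *)
Inductive tail : nat -> R -> seq R -> Prop :=
| tail0 e u : block u -> tail 0 e (scale e u)
| tailS n e u t : block u -> tail n (- e) t ->
    tail n.+1 e (scale (2 * e) u ++ t).

Definition zig n (s : seq R) := exists e u t,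
  [/\ `|e| = 1, block u, tail n e t & s = scale (- e) u ++ t].

Lemma l1_scale e u : block u -> l1 (scale e u) = `|e|.
Proof.
move=> [/allP h s]; rewrite /l1 big_map -[RHS]mulr1 -s mulr_sumr big_seq [RHS]big_seq.
by apply: eq_bigr => a /h a0; rewrite normrM (ger0_norm a0).
Qed.

Lemma l1_cat s t : l1 (s ++ t) = l1 s + l1 t.
Proof. exact: big_cat. Qed.

Lemma tail_l1 n e t : tail n e t -> l1 t = (2 * n + 1)%:R * `|e|.
Proof.
elim=> {n e t} [e u bu|n e u t bu _ IH]; first by rewrite l1_scale// mul1r.
rewrite l1_cat l1_scale// IH normrM normrN normr_nat -[n.+1]addn1 mulnDr !natrD !natrM.
ring.
Qed.

Lemma zig_l1 n s : zig n s -> l1 s = (2 * n.+1)%:R.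
Proof.
move=> [e [u [t [e1 bu /tail_l1 + ->]]]]; rewrite e1 => h.
by rewrite l1_cat l1_scale// normrN e1 h mulr1 nat1r; rewrite mulnS addn1.
Qed.

(** The two copies of an inner block enter [A] with equal signs and [D] with opposite signs. In [D]
    the second copy therefore merges with the first copy of the next block; this shifts the grouping
    by one, and the block [v] in front completes the first pair. *)
Lemma tail_double n e t : tail n e t -> exists A D,
  [/\ size A = size D, (forall z, sp z (addl A D) = sp z t),
      (forall z, sp z (subl A D) = sp z t), tail n e A &
      forall v, block v -> tail n e (scale e v ++ D)].
Proof.
elim=> {n e t} [e u bu|n e u t bu _ [A [D [sAD h1 h2 tA tD]]]].
  exists (scale e u), (scale 0 u); rewrite /= !size_map addl_scale subl_scale.
  rewrite addr0 subr0; split => //; first exact: tail0.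
  by move=> v bv; rewrite scale0 -(scale_nseq0 e) -scale_cat; apply/tail0/block0r.
have mid v : block v -> scale e v ++ scale e u = scale (2 * e) (scale 2^-1 (v ++ u)).
  by move=> bv; rewrite scaleA -scale_cat; congr (scale _ _); field.
exists (scale e u ++ scale e u ++ A), (scale e u ++ scale (- e) u ++ D); split.
- by rewrite !size_cat !size_map sAD.
- move=> z; rewrite !addl_cat ?size_map// !addl_scale subrr scale0.
  rewrite (_ : e + e = 2 * e); last by rewrite mulrDl mul1r.
  by apply: sp_cat => w; rewrite sp_zeros.
- move=> z; rewrite !subl_cat ?size_map// !subl_scale subrr scale0 opprK.
  rewrite (_ : e + e = 2 * e); last by rewrite mulrDl mul1r.
  by rewrite sp_zeros; exact: sp_cat.
- by rewrite catA mid//; apply: tailS => //; exact: block_mid.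
- move=> v bv; rewrite catA mid//; apply: tailS; first exact: block_mid.
  exact: tD.
Qed.

Lemma tail_inv n e s : tail n.+1 e s ->
  exists u t, [/\ block u, tail n (- e) t & s = scale (2 * e) u ++ t].
Proof.
by move E : n.+1 => m h; case: h E => // k e' u t bu ht [->]; exists u, t.
Qed.

Lemma tail0_inv e s : tail 0 e s -> exists2 u, block u & s = scale e u.
Proof. by move E : 0%N => m h; case: h E => // e' u bu _; exists u. Qed.

(** The outer block [u] has coefficient 0 in [D], so [D] starts with the first inner block and has
    one level less. Sum and difference of [A] and [D] are both [s] with zeros inserted, and [sp_nj]
    applies. *)
Lemma zig_double n s : zig n.+1 s -> exists A D,
  [/\ zig n.+1 A, zig n D & sp 0 A ^+ 2 + sp 0 D ^+ 2 <= c * sp 0 s ^+ 2].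
Proof.
move=> [e [u [_ [e1 bu /tail_inv[u1 [t [bu1 ht ->]]] ->]]]].
have [A [D [sAD h1 h2 tA tD]]] := tail_double ht.
exists (scale (- e) u ++ scale e u1 ++ scale e u1 ++ A).
exists (scale 0 u ++ scale e u1 ++ scale (- e) u1 ++ D); split.
- exists e, u, (scale e u1 ++ scale e u1 ++ A); split => //.
  rewrite catA -scale_cat (_ : scale e (u1 ++ u1) =
    scale (2 * e) (scale 2^-1 (u1 ++ u1))); last first.
    by rewrite scaleA; congr (scale _ _); field.
  by apply: tailS => //; exact: block_mid.
- exists (- e), (nseq (size u) 0 ++ u1), (scale (- e) u1 ++ D); split => //.
  + by rewrite normrN.
  + exact: block0l.
  + exact: tD.
  + by rewrite opprK scale_cat scale_nseq0 scale0 !catA.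
- have := @sp_nj 0 0 (scale (- e) u ++ scale e u1 ++ scale e u1 ++ A)
    (scale 0 u ++ scale e u1 ++ scale (- e) u1 ++ D).
  rewrite !size_cat !size_map sAD => /(_ erefl) h; apply: (le_trans h).
  rewrite !addl_cat ?size_map// !subl_cat ?size_map// !addl_scale !subl_scale.
  rewrite opprK !subrr addr0 !subr0 addr0 !scale0.
  rewrite (_ : e + e = 2 * e); last by rewrite mulrDl mul1r.
  rewrite (_ : sp 0 (_ ++ _ ++ _ ++ addl _ _) =
      sp 0 (scale (- e) u ++ scale (2 * e) u1 ++ t)); last first.
    by apply: sp_cat => z; apply: sp_cat => w; rewrite sp_zeros.
  rewrite (_ : sp 0 (_ ++ _ ++ _ ++ subl _ _) =
      sp 0 (scale (- e) u ++ scale (2 * e) u1 ++ t)); last first.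
    by apply: sp_cat => z; rewrite sp_zeros; exact: sp_cat.
  lra.
Qed.

Lemma zig_exists n : exists s, zig n s.
Proof.
have b1 : block [:: 1 : R] by split; rewrite ?big_seq1//= ler01.
have [t ht] : exists t, tail n 1 t.
  elim: n (1 : R) => [|n IH] e; first by exists (scale e [:: 1]); exact: tail0.
  by have [t ht] := IH (- e); exists (scale (2 * e) [:: 1] ++ t); exact: tailS.
by exists (scale (- 1) [:: 1] ++ t), 1, [:: 1], t; split; rewrite ?normr1.
Qed.

Definition zinf n : R := inf [set sp 0 s ^+ 2 | s in zig n]%classic.

Lemma zinf_le n s : zig n s -> zinf n <= sp 0 s ^+ 2.
Proof.
move=> h; apply: ge_inf; last by exists s.
by exists 0 => _ [t _ <-]; rewrite sqr_ge0.
Qed.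

Lemma zinf_ge n r : (forall s, zig n s -> r <= sp 0 s ^+ 2) -> r <= zinf n.
Proof.
move=> h; apply: lb_le_inf => [|_ [t ht <-]]; last exact: h.
by have [s hs] := zig_exists n; exists (sp 0 s ^+ 2), s.
Qed.

(** Passing to infima in [zig_double] gives [zinf n.+1 + zinf n <= c * zinf n.+1]. *)
Lemma zinf_step n : 0 < c -> zinf n <= (c - 1) * zinf n.+1.
Proof.
move=> c0.
have : (zinf n.+1 + zinf n) / c <= zinf n.+1.
  apply: zinf_ge => s /zig_double[A [D [zA zD h]]].
  rewrite ler_pdivrMr// mulrC (le_trans _ h)// lerD//; exact: zinf_le.
rewrite ler_pdivrMr//; nra.
Qed.

Lemma zinf_geom n : 1 < c -> zinf 0 <= (c - 1) ^+ n * zinf n.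
Proof.
move=> c1; elim: n => [|n IH]; first by rewrite mul1r.
rewrite (le_trans IH)// exprSr -mulrA ler_wpM2l//.
  by rewrite exprn_ge0// subr_ge0 ltW.
by apply: zinf_step; rewrite (lt_trans ltr01).
Qed.

Lemma zinf_ub n : zinf n <= (M * (2 * n.+1)%:R) ^+ 2.
Proof.
have [s zs] := zig_exists n; rewrite (le_trans (zinf_le zs))//.
have /andP[s0 s1] := sp_bounds 0 s.
rewrite nrm0 add0r (zig_l1 zs) in s1.
by rewrite ler_sqr// nnegrE// (le_trans s0).
Qed.

End spreading.

(** Bernoulli's inequality bounds g^k by 1 / (h (k + 1)); the cube of this bound, at n = 3 k, beats
    the quadratic factor. *)
Lemma geom_poly (R : realType) (g B e : R) : 0 < g < 1 -> 0 < e ->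
  exists n, g ^+ n * (B * (2 * n.+1)%:R) ^+ 2 < e.
Proof.
move=> /andP[g0 g1] e0.
(* The minimum with 1 makes the case k = 0 of the bound h (k + 1) <= g^(-k) true. *)
pose h := Num.min 1 (g^-1 - 1).
have h0 : 0 < h by rewrite lt_min ltr01 subr_gt0 invf_gt1.
have [k hk] : exists k : nat, 36 * B ^+ 2 / (e * h ^+ 3) < k.+1%:R.
  exists (Num.bound (36 * B ^+ 2 / (e * h ^+ 3))).
  rewrite (lt_le_trans (archi_boundP _)) ?ler_nat//.
  have := sqr_ge0 B; have := exprn_gt0 3 h0 => h3 B2.
  by rewrite divr_ge0//; nra.
exists (3 * k)%N.
have bern : g ^+ k * (h * k.+1%:R) <= 1.
  have : h * k.+1%:R <= (g^-1) ^+ k.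
    elim: {hk} k => [|k IH]; first by rewrite mulr1 expr0 ge_min lexx.
    have hg : h <= g^-1 - 1 by rewrite ge_min lexx orbT.
    have gk : 1 <= (g^-1) ^+ k by rewrite exprn_ege1// invf_ge1// ltW.
    rewrite exprS -[k.+2]addn1 natrD; nra.
  move=> /(ler_wpM2l (exprn_ge0 k (ltW g0))) /le_trans; apply.
  by rewrite exprVn mulfV// expf_neq0// gt_eqF.
rewrite ltr_pdivrMr ?mulr_gt0 ?exprn_gt0// in hk.
have n36 : (2 * (3 * k).+1)%:R <= 6 * k.+1%:R :> R.
  rewrite -natrM ler_nat -[6%N]/(2 * 3)%N -mulnA leq_mul2l/= mulnS.
  by rewrite -addn1 addnC leq_add2r.
have k0 : 0 < k.+1%:R :> R by rewrite ltr0n.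
set a := g ^+ k in bern; set K : R := k.+1%:R in bern hk k0 n36.
have a0 : 0 < a by rewrite exprn_gt0.
set N : R := (2 * _)%:R in n36 *; rewrite mulnC exprM -/a exprMn.
have N0 : 0 <= N by rewrite ler0n.
have N2 : N ^+ 2 <= 36 * K ^+ 2.
  rewrite (_ : 36 * K ^+ 2 = (6 * K) ^+ 2); last by ring.
  by rewrite ler_sqr// nnegrE (le_trans N0).
have b3 : a ^+ 3 * (h ^+ 3 * K ^+ 3) <= 1.
  by rewrite -!exprMn exprn_ile1// mulr_ge0 ?mulr_ge0 ?ltW.
apply: (@le_lt_trans _ _ (a ^+ 3 * (36 * B ^+ 2) * K ^+ 2)).
  rewrite (_ : _ * _ * _ = a ^+ 3 * (B ^+ 2 * (36 * K ^+ 2))); last by ring.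
  apply: ler_wpM2l; first by rewrite exprn_ge0// ltW.
  by apply: ler_wpM2l; rewrite ?sqr_ge0.
apply: (@lt_le_trans _ _ (a ^+ 3 * (K * (e * h ^+ 3)) * K ^+ 2)).
  by rewrite ltr_pM2r ?exprn_gt0// ltr_pM2l ?exprn_gt0.
rewrite (_ : _ * _ * _ = e * (a ^+ 3 * (h ^+ 3 * K ^+ 3))); last by ring.
by rewrite ger_pMr.
Qed.

(** * Early and late convex combinations: infinite and uniform finite forms *)

Section james.
Variables (R : realType) (c : R).
Hypothesis c12 : 1 < c < 2.

Lemma pathlt_all n0 ns : path ltn n0 ns -> all (fun k => n0 < k)%N ns.
Proof. by move/(order_path_min ltn_trans). Qed.

Lemma path_le_last n0 ns k : path ltn n0 ns -> k \in ns -> (k <= last n0 ns)%N.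
Proof.
elim: ns n0 => //= n ns IH n0 /andP[_ pn]; rewrite inE => /orP[/eqP->|]; last exact: IH.
case: ns pn {IH} => // m ns pn; have := pathlt_all pn => /allP/(_ (last n (m :: ns))).
by rewrite /= mem_last => /(_ isT)/ltnW.
Qed.

Lemma nat_seq_bound (ns : seq nat) : exists b, all (fun k => k < b)%N ns.
Proof.
elim: ns => [|k ns [b hb]]; first by exists 0%N.
exists (maxn k.+1 b); rewrite /= leq_maxl; apply/allP => i /(allP hb) ib.
by rewrite leq_max ib orbT.
Qed.

(** If all early and late combinations were more than [th] apart, [zinf x 0] would be at least
    [th ^+ 2], and the growth in [zinf_geom] would overtake the quadratic bound [zinf_ub]. *)
Lemma james_infinite (V : njSpace c) (x : nat -> V) M th :
  (forall i, nrm (x i) <= M) -> 0 < th ->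
  exists j m a b, [/\ wts a j, wts b m &
    nrm (\sum_(i < j) a i *: x i - \sum_(i < m) b i *: x (j + i)%N) <= th].
Proof.
move=> xM th0; apply: contrapT => H.
have sep j m a b : wts a j -> wts b m ->
    th <= nrm (\sum_(i < j) a i *: x i - \sum_(i < m) b i *: x (j + i)%N).
  move=> ha hb; rewrite leNgt; apply/negP => h; apply: H.
  by exists j, m, a, b; split => //; exact: ltW.
have /andP[c1 c2] := c12.
have z0 : th ^+ 2 <= zinf x 0.
  apply: zinf_ge => s [e [u [_ [e1 bu /tail0_inv[v bv ->] ->]]]].
  rewrite ler_sqr ?nnegrE ?(sp_ge0 xM) ?(ltW th0)//.
  apply: (sp_lower xM (n0 := 0%N)) => ns pns; rewrite size_cat !size_map => sz.
  pose ns1 := take (size u) ns; pose ns2 := drop (size u) ns.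
  have s1 : size ns1 = size u by rewrite size_takel// sz leq_addr.
  have s2 : size ns2 = size v by rewrite size_drop sz addKn.
  have nsE : ns = ns1 ++ ns2 by rewrite cat_take_drop.
  move: pns; rewrite nsE cat_path => /andP[p1 p2].
  (* The cut just after the last index of the first block; all indices of the second block lie
     beyond it. *)
  pose j := (last 0 ns1).+1%N.
  have a1 : all (fun k => 0 <= k < 0 + j)%N ns1.
    apply/allP => k /= kn; rewrite add0n ltnS.
    exact: (path_le_last p1).
  have [n2 hn2] := nat_seq_bound ns2.
  have a2 : all (fun k => j <= k < j + n2)%N ns2.
    apply/allP => k kn; have := allP (pathlt_all p2) _ kn; rewrite /j => ->/=.
    by rewrite (leq_trans (allP hn2 _ kn))// leq_addl.
  have [a [wa Ea]] := weights_of_block x bu s1 a1.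
  have [b [wb Eb]] := weights_of_block x bv s2 a2.
  have E f w nl : \sum_(p <- zip (scale f w) nl) p.1 *: x p.2 =
      f *: \sum_(p <- zip w nl) p.1 *: x p.2.
    elim: w nl => [|q w IH] [|k nl] /=; rewrite ?big_nil ?scaler0//.
    by rewrite !big_cons IH scalerDr scalerA.
  rewrite add0r zip_cat ?size_map// big_cat/= !E Ea Eb.
  rewrite scaleNr addrC -scalerBr nrmZ e1 mul1r nrmC.
  have := sep _ _ _ _ wa wb.
  by under eq_bigr do rewrite -[(nat_of_ord _)]add0n.
have g01 : 0 < c - 1 < 1 by lra.
have [n hn] := geom_poly M g01 (exprn_gt0 2 th0).
have := le_lt_trans (ler_wpM2l (exprn_ge0 n (ltW (proj1 (andP g01)))) (zinf_ub xM n)) hn.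
by rewrite ltNge => /negP; apply; rewrite (le_trans z0)// (zinf_geom xM).
Qed.

(** Compactness through the ultrapower: counterexamples for every [N] form one sequence [X] there,
    and the combinations found for it work at almost every coordinate, also at some [N >= j + m].
    Uniformity of [N] allows the length of a chain to be fixed before the chain is built. *)
Lemma james (V : njSpace c) M th : 0 < th -> exists N : nat, forall x : nat -> V,
  (forall i, nrm (x i) <= M) ->
  exists j m a b, [/\ (j + m <= N)%N, wts a j, wts b m &
    nrm (\sum_(i < j) a i *: x i - \sum_(i < m) b i *: x (j + i)%N) <= th].
Proof.
move=> th0; apply: contrapT => H.
have H1 N : exists x : nat -> V, (forall i, nrm (x i) <= M) /\ forall j m a b,
    (j + m <= N)%N -> wts a j -> wts b m ->
    th < nrm (\sum_(i < j) a i *: x i - \sum_(i < m) b i *: x (j + i)%N).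
  apply: contrapT => h; apply: H; exists N => x xM; apply: contrapT => h2.
  apply: h; exists x; split => // j m a b jm wa wb; rewrite ltNge; apply/negP => h3.
  by apply: h2; exists j, m, a, b.
have [y /all_and2[yM hy]] := choice H1.
pose X i : upow V := mkU (fun N => y N i).
have XE i N : X i N = y N i by rewrite (mkUE (M := M)).
have th2 : 0 < th / 2 by rewrite divr_gt0.
have [i|j [m [a [b [wa wb h]]]]] := @james_infinite (upow V) X M _ _ th2.
  by apply: unrm_le; apply: U_all => N; rewrite XE.
have : U (fun N => (j + m <= N)%N /\
  nrm (\sum_(i < j) a i *: y N i - \sum_(i < m) b i *: y N (j + i)%N) < th).
  apply: U_and; first exact: U_ge.
  have : nrm (\sum_(i < j) a i *: X i - \sum_(i < m) b i *: X (j + i)%N) < th.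
    by rewrite (le_lt_trans h)// gtr_pMr// invf_lt1// ltr1n.
  have S n (f : nat -> upow V) N :
      uval (\sum_(i < n) f i : upow V) N = \sum_(i < n) f i N.
    elim: n => [|n IH]; first by rewrite !big_ord0.
    by rewrite !big_ord_recr/= -IH.
  move/unrm_lt; apply: U_mono => N.
  have -> : uval (\sum_(i < j) a i *: X i - \sum_(i < m) b i *: X (j + i)%N : upow V) N =
     uval (\sum_(i < j) a i *: X i : upow V) N -
     uval (\sum_(i < m) b i *: X (j + i)%N : upow V) N by [].
  rewrite (S j (fun i => a i *: X i)) (S m (fun i => b i *: X (j + i)%N)).
  under eq_bigr do rewrite uvalZ XE.
  by under [X in _ - X]eq_bigr do rewrite uvalZ XE.
move=> /U_ex[N [jmN]]; rewrite ltNge => /negP; apply; apply: ltW; exact: hy.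
Qed.

End james.

(** * Fixed points of commuting families *)

Section defs.
Variables (R : realType) (c : R).

Section space.
Variable V : njSpace c.

Record domain (K : set V) (M : R) : Prop := Domain {
  dom_ex : exists x, K x;
  dom_convex : convex_in K;
  dom_complete : complete_in K;
  dom_bound : forall x, K x -> nrm x <= M }.

Record nonexp_family (I : Type) (K : set V) (S : I -> V -> V) : Prop :=
  NonexpFamily {
  fam_maps : forall i x, K x -> K (S i x);
  fam_nonexp : forall i x y, K x -> K y -> nrm (S i x - S i y) <= nrm (x - y);
  fam_comm : forall i j x, K x -> S i (S j x) = S j (S i x) }.

Lemma sub_family I J (g : J -> I) (K L : set V) (S : I -> V -> V) :
  nonexp_family K S -> (forall x, L x -> K x) ->
  (forall j x, L x -> L (S (g j) x)) -> nonexp_family L (S \o g).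
Proof.
move=> [h1 h2 h3] LK h; split => //.
- by move=> i x y /LK Kx /LK Ky; exact: h2.
- by move=> i j x /LK Kx; exact: h3.
Qed.

Lemma sub_domain (K L : set V) M : domain K M -> (forall x, L x -> K x) ->
  (exists x, L x) -> convex_in L ->
  (forall u x, (forall n, L (u n)) -> K x -> ncvg u x -> L x) -> domain L M.
Proof.
move=> [_ _ hc hb] LK ex cv cl; split => //; last by move=> x /LK; exact: hb.
move=> u Lu cu; have [x Kx ux] := hc u (fun n => LK _ (Lu n)) cu.
by exists x => //; exact: cl ux.
Qed.

Lemma nrm_half (x y z : V) :
  nrm (2^-1 *: x + 2^-1 *: y - z) <= 2^-1 * nrm (x - z) + 2^-1 * nrm (y - z).
Proof.
have := @nrm_convB _ _ V 2^-1 x y z; rewrite (_ : 1 - 2^-1 = 2^-1); last by field.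
by apply; lra.
Qed.

Lemma convex_half (K : set V) x y : convex_in K -> K x -> K y ->
  K (2^-1 *: x + 2^-1 *: y).
Proof.
move=> cK Kx Ky; have := cK 2^-1 x y.
rewrite (_ : 1 - 2^-1 = 2^-1); last by field.
by apply => //; lra.
Qed.

End space.

(* Approximate and exact common fixed points of [k] commuting maps. Since [nrm]
   is a seminorm, a fixed point is only fixed up to a vector of norm 0. *)
Definition afp k := forall (V : njSpace c) (K : set V) M (S : 'I_k -> V -> V),
  domain K M -> nonexp_family K S ->
  forall d, 0 < d -> exists2 x, K x & forall i, nrm (S i x - x) <= d.

Definition fpp k := forall (V : njSpace c) (K : set V) M (S : 'I_k -> V -> V),
  domain K M -> nonexp_family K S ->
  exists2 x, K x & forall i, nrm (S i x - x) = 0.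

Lemma fpp0 : fpp 0.
Proof. by move=> V K M S [[x Kx] _ _ _] _; exists x => // -[]. Qed.

(** * Approximate fixed points by the Goebel-Kirk iteration *)

Section goebel_kirk.
Variable k : nat.
Hypothesis fppk : fpp k.
Variables (V : njSpace c) (K : set V) (M : R) (S : 'I_k.+1 -> V -> V).
Hypotheses (dK : domain K M) (fS : nonexp_family K S).
Let B := S ord0.
Let A (i : 'I_k) := S (lift ord0 i).

Definition Afix : set V := fun x => K x /\ forall i, nrm (A i x - x) = 0.

Lemma Afix_ex : exists x, Afix x.
Proof.
have [x Kx hx] : exists2 x, K x & forall i, nrm (A i x - x) = 0.
  apply: (fppk dK); apply: (sub_family (g := lift ord0) fS) => // j x.
  exact: (fam_maps fS).
by exists x.
Qed.

Lemma Afix_B x : Afix x -> Afix (B x).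
Proof.
move=> [Kx hx]; split; first exact: (fam_maps fS).
move=> i; apply/le_anti; rewrite nrm_ge0 andbT -(hx i) /A (fam_comm fS)//.
by apply: (fam_nonexp fS) => //; exact: (fam_maps fS).
Qed.

(* Substitute for a nonexpansive retraction onto [Afix]: the midpoint of [y]
   and [B y] can be moved into [Afix] without increasing its distance to any
   point of [Afix]. *)
Lemma Afix_step y : Afix y -> exists y', Afix y' /\
  forall f, Afix f -> nrm (y' - f) <= nrm (2^-1 *: y + 2^-1 *: B y - f).
Proof.
move=> Fy; set v := _ + _.
have Kv : K v.
  apply: convex_half (Fy.1) _; first exact: (dom_convex dK).
  exact: (fam_maps fS) Fy.1.
pose Q : set V := fun z => K z /\ forall f, Afix f -> nrm (z - f) <= nrm (v - f).
have dQ : domain Q M.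
  apply: (sub_domain dK); first by move=> x [].
  - by exists v; split.
  - move=> t x z t01 [Kx hx] [Kz hz]; split; first exact: (dom_convex dK).
    move=> f Ff; apply: (le_trans (nrm_convB _ _ _ t01)).
    have /andP[t0 t1] := t01; have := hx f Ff; have := hz f Ff; nra.
  - move=> u x Qu Kx ux; split => // f Ff.
    by apply: (ncvg_le ux) => n; exact: (Qu n).2.
have [y' [Ky' hy'] h] : exists2 y', Q y' & forall i, nrm (A i y' - y') = 0.
  apply: (fppk dQ); apply: (sub_family (g := lift ord0) fS) => [x []//|j x [Kx hx]].
  split; first exact: (fam_maps fS).
  move=> f [Kf hf]; apply: (le_trans (nrm_tri (A j f) _ _)).
  rewrite hf addr0; apply: le_trans (hx f (conj Kf hf)).
  exact: (fam_nonexp fS).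
by exists y'; split; first split.
Qed.

(** If the infimum [m] of the displacement of [B] on [Afix] were positive, averaging steps from a
    nearly minimal point would run almost straight: [B (y n)] would be about (1 + n / 2) m away from
    [y 0], beyond the diameter bound 2 M. *)
Lemma goebel_kirk d : 0 < d -> exists2 x, Afix x & nrm (B x - x) <= d.
Proof.
move=> d0; apply: contrapT => H.
have Hd x : Afix x -> d <= nrm (B x - x).
  by move=> Fx; rewrite leNgt; apply/negP => h; apply: H; exists x => //; exact: ltW.
have [g hg] : exists g, forall y, Afix y -> Afix (g y) /\
    forall f, Afix f -> nrm (g y - f) <= nrm (2^-1 *: y + 2^-1 *: B y - f).
  have h y : exists y', Afix y -> Afix y' /\
      forall f, Afix f -> nrm (y' - f) <= nrm (2^-1 *: y + 2^-1 *: B y - f).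
    have [Fy|nF] := pselect (Afix y); last by exists y.
    by have [y' hy'] := Afix_step Fy; exists y'.
  by have [g hg] := choice h; exists g.
pose E : set R := [set nrm (B y - y) | y in Afix]%classic.
have hE : has_inf E.
  split; last by exists d => _ [y Fy <-]; exact: Hd.
  by have [y Fy] := Afix_ex; exists (nrm (B y - y)), y.
pose m := inf E.
have mle y : Afix y -> m <= nrm (B y - y).
  by move=> Fy; apply: ge_inf; [exact: hE.2|exists y].
have m0 : 0 < m.
  by apply: (lt_le_trans d0); apply: lb_le_inf; [exact: hE.1|move=> _ [y /Hd ? <-]].
pose n := (Num.bound (2 * (2 * M + 1) / m)).
have M0 : 0 <= M.
  have [x [Kx _]] := Afix_ex; exact: le_trans (nrm_ge0 x) (dom_bound dK Kx).
have hn : 2 * M + 1 < (1 + n%:R / 2) * m.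
  have : 2 * (2 * M + 1) / m < n%:R by apply: archi_boundP; rewrite divr_ge0//; lra.
  by rewrite ltr_pdivrMr// => h; nra.
(* The error term [3 ^+ n * e] of [key] becomes 1, which the choice of [n] has left room for. *)
pose e : R := (3 ^+ n)^-1.
have e0 : 0 < e by rewrite invr_gt0 exprn_gt0.
have [_ [y0 Fy0 <-] hy0] := inf_adherent e0 hE; rewrite -/m in hy0.
pose y i := iter i g y0.
have Fy i : Afix (y i) by elim: i => //= i /hg[].
have Ky i : K (y i) := (Fy i).1.
have ny i j : nrm (B (y i) - B (y j)) <= nrm (y i - y j) by exact: (fam_nonexp fS).
have hS i f : Afix f -> nrm (y i.+1 - f) <= 2^-1 * nrm (y i - f) + 2^-1 * nrm (B (y i) - f).
  move=> Ff; apply: le_trans (nrm_half _ _ _); exact: (hg _ (Fy i)).2.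
have s1 i : nrm (y i.+1 - y i) <= 2^-1 * nrm (B (y i) - y i).
  by have := hS i _ (Fy i); rewrite subrr nrm0 mulr0 add0r.
have s2 i : nrm (y i.+1 - B (y i)) <= 2^-1 * nrm (B (y i) - y i).
  by have := hS i _ (Afix_B (Fy i)); rewrite subrr nrm0 mulr0 addr0 [nrm (y i - _)]nrmC.
have Dle i : nrm (B (y i) - y i) <= m + e.
  elim: i => [|i IH]; first exact: ltW.
  apply: (le_trans (nrm_tri (B (y i)) _ _)).
  have := ny i.+1 i; have := s1 i; have := s2 i; rewrite (nrmC (B (y i)) (y i.+1)).
  lra.
have dist i j : nrm (y i - y (i + j)%N) <= j%:R * ((m + e) / 2).
  elim: j => [|j IH]; first by rewrite addn0 subrr nrm0 mul0r.
  apply: (le_trans (nrm_tri (y (i + j)%N) _ _)).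
  rewrite addnS [X in _ + X]nrmC -natr1.
  have := s1 (i + j)%N; have := Dle (i + j)%N; lra.
(* The induction step doubles the error and adds (p + 1) e / 2, which is at most 3^p e; hence the
   powers of 3. *)
have key p i : (1 + p%:R / 2) * m - 3 ^+ p * e <= nrm (B (y (i + p)%N) - y i).
  elim: p i => [|p IH] i.
    rewrite addn0 mul0r addr0 mul1r expr0 mul1r; have := mle _ (Fy i); lra.
  have h1 := IH i.+1; rewrite addSnnS in h1.
  have h2 := hS i _ (Afix_B (Fy (i + p.+1)%N)).
  have h3 := ny i (i + p.+1)%N; have h4 := dist i p.+1.
  rewrite nrmC in h2; rewrite [nrm (y i - B _)]nrmC in h2.
  rewrite exprS -natr1 in h4 *.
  have h5 : p%:R + 1 <= 2 * 3 ^+ p :> R.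
    rewrite natr1 -natrX -natrM ler_nat.
    by rewrite (leq_trans (ltn_expl p (isT : 1 < 3)%N))// leq_pmull.
  have h6 : (p%:R + 1) * e <= 2 * 3 ^+ p * e by rewrite ler_wpM2r// ltW.
  nra.
have := key n 0%N; rewrite /e mulfV ?expf_neq0 ?pnatr_eq0// => h.
have := nrmB (B (y (0 + n)%N)) (y 0%N).
have := dom_bound dK (Ky 0%N); have := dom_bound dK (fam_maps fS ord0 (Ky (0 + n)%N)).
rewrite -/B; lra.
Qed.

End goebel_kirk.

Lemma afpS k : fpp k -> afp k.+1.
Proof.
move=> fppk V K M S dK fS d d0.
have [x [Kx hx] h] := goebel_kirk fppk dK fS d0.
exists x => // i; case: (unliftP ord0 i) => [j ->|-> //].
by rewrite hx ltW.
Qed.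

End defs.

(** * Convex combinations and barycenters *)

Section weighted.
Variables (R : realType) (c : R).

(** Peels off the last point to allow induction on convex combinations; rescaling the other weights
    by [1 - a n] forces the separate case of a last weight 1. *)
Lemma wts_split (V : njSpace c) (a : nat -> R) n : wts a n.+1 ->
  (forall q : nat -> V, \sum_(i < n.+1) a i *: q i = q n) \/
  exists2 a', wts a' n & 0 <= 1 - a n <= 1 /\ forall q : nat -> V,
    \sum_(i < n.+1) a i *: q i =
    (1 - a n) *: (\sum_(i < n) a' i *: q i) + (1 - (1 - a n)) *: q n.
Proof.
move=> [a0 s1]; move: (s1); rewrite big_ord_recr /= => s.
have S0 : 0 <= \sum_(i < n) a i by apply: sumr_ge0.
have [an1|an1] := eqVneq (a n) 1.
  left => q; rewrite big_ord_recr /= an1 scale1r.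
  rewrite big1 ?add0r// => i _.
  have /eqP : \sum_(i < n) a i = 0 by lra.
  rewrite psumr_eq0// => /allP/(_ i); rewrite mem_index_enum => /(_ isT)/eqP ->.
  by rewrite scale0r.
have an0 := a0 n; have an2 : 0 < 1 - a n by rewrite lt_neqAle eq_sym subr_eq0 eq_sym an1/=; lra.
right; exists (fun i => (1 - a n)^-1 * a i).
  split; first by move=> i; rewrite mulr_ge0// invr_ge0 ltW.
  by rewrite -mulr_sumr (_ : \sum_(i < n) a i = 1 - a n) ?mulVf ?gt_eqF//; lra.
split; first by lra.
move=> q; rewrite big_ord_recr /= subKr; congr (_ + _).
rewrite scaler_sumr; apply: eq_bigr => i _.
by rewrite scalerA mulrA mulfV ?mul1r ?gt_eqF.
Qed.

Lemma wts0 (a : nat -> R) : ~ wts a 0.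
Proof. by case=> _; rewrite big_ord0 => /eqP; rewrite eq_sym oner_eq0. Qed.

Variable V : njSpace c.

Lemma convex_sum (K : set V) a n (q : nat -> V) : convex_in K -> wts a n ->
  (forall i, (i < n)%N -> K (q i)) -> K (\sum_(i < n) a i *: q i).
Proof.
move=> cK; elim: n a => [|n IH] a; first by move=> /wts0.
move=> /(wts_split V)[->|[a' wa' [t01 ->]]] h; first exact: h.
by apply: cK => //; [apply: IH => // i /ltnW|]; exact: h.
Qed.

Lemma nrm_wsum (a : nat -> R) n (q : nat -> V) z r : wts a n ->
  (forall i, (i < n)%N -> nrm (q i - z) <= r) ->
  nrm (\sum_(i < n) a i *: q i - z) <= r.
Proof.
move=> wa h; apply: (convex_sum (K := fun x => nrm (x - z) <= r)) => //.
move=> t x y t01 hx hy; apply: (le_trans (nrm_convB _ _ _ t01)).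
by have /andP[t0 t1] := t01; nra.
Qed.

(** The segments from a net of the smaller hull to the new vertex are cut by a grid of mesh 1 / D.
    The finite net replaces demands on a whole hull by finitely many, under which [ev] is stable. *)
Lemma hull_totally_bounded (K : set V) M n (q : nat -> V) e : convex_in K ->
  (forall x, K x -> nrm x <= M) -> (forall i, (i < n)%N -> K (q i)) -> 0 < e ->
  exists L : seq V, (forall l, l \in L -> K l) /\
    forall a, wts a n -> exists2 l, l \in L & nrm (\sum_(i < n) a i *: q i - l) <= e.
Proof.
move=> cK KM; elim: n e => [|n IH] e hq e0.
  by exists [::]; split => // a /wts0.
have e20 : 0 < e / 2 by rewrite divr_gt0.
have [L [LK hL]] := IH _ (fun i h => hq i (ltnW h)) e20.
have Kq := hq n (ltnSn n).
have M0 : 0 <= M := le_trans (nrm_ge0 _) (KM _ Kq).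
pose D := (Num.bound (4 * M / e)).+1.
have hD : 2 * M <= D%:R * (e / 2).
  have : 4 * M / e < D%:R.
    rewrite (lt_le_trans (archi_boundP _)) ?ler_nat// divr_ge0 ?mulr_ge0//.
    exact: ltW.
  by rewrite ltr_pdivrMr//; lra.
have D0 : 0 < D%:R :> R by rewrite ltr0n.
pose pt (l : V) (k : nat) := (k%:R / D%:R) *: l + (1 - k%:R / D%:R) *: q n.
exists (q n :: [seq pt l k | l <- L, k <- iota 0 D.+1]); split.
  move=> l; rewrite inE => /orP[/eqP ->//|/allpairsP[[x k] [xL + ->]]].
  rewrite mem_iota add0n ltnS => /andP[_ kD]; apply: cK => //; last exact: LK.
  by rewrite divr_ge0//= ler_pdivrMr// mul1r ler_nat.
move=> a /(wts_split V)[->|[a' wa' [t01 ->]]].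
  by exists (q n); rewrite ?mem_head// subrr nrm0 ltW.
move: (1 - a n) t01 => t t01; set y := \sum_(i < n) _.
have [l lL hl] := hL _ wa'; rewrite -/y in hl.
have /andP[t0 t1] := t01.
have tD0 : 0 <= t * D%:R by rewrite mulr_ge0// ltW.
have [k [kD k1 k2]] : exists k, [/\ (k <= D)%N, k%:R <= t * D%:R & t * D%:R <= k%:R + 1].
  exists (Num.truncn (t * D%:R)).
  have /andP[h1 h2] := truncn_itv tD0; split => //; last by rewrite natr1 ltW.
  by rewrite -(ler_nat R) (le_trans h1)// ler_piMl// ltW.
exists (pt l k).
  rewrite inE; apply/orP; right; apply/allpairsP; exists (l, k); split => //.
  by rewrite mem_iota add0n ltnS.
apply: (le_trans (nrm_tri (t *: l + (1 - t) *: q n) _ _)).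
have -> : t *: y + (1 - t) *: q n - (t *: l + (1 - t) *: q n) = t *: (y - l).
  by rewrite opprD addrACA subrr addr0 scalerBr.
have -> : t *: l + (1 - t) *: q n - pt l k = (t - k%:R / D%:R) *: (l - q n).
  rewrite /pt opprD addrACA -!scalerBl scalerBr; congr (_ + _).
  by rewrite -scaleNr; congr (_ *: _); ring.
rewrite !nrmZ ger0_norm// (splitr e) lerD//; first by nra.
have h1 : 0 <= t - k%:R / D%:R by rewrite subr_ge0 ler_pdivrMr.
have h2 : t - k%:R / D%:R <= D%:R^-1.
  by rewrite -(ler_pM2r D0) mulrBl divfK ?gt_eqF// mulVf ?gt_eqF//; lra.
rewrite ger0_norm//.
have := nrmB l (q n); have := KM _ (LK _ lL); have := KM _ Kq => n1 n2 n3.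
apply: (@le_trans _ _ (D%:R^-1 * (2 * M))).
  by apply: ler_pM => //; [exact: nrm_ge0|lra].
by rewrite ler_pdivrMl.
Qed.

(* With [t = r / 2] this contradicts [c < 2] when the [w i] are at distance
   almost [r] from the barycenter of the [q i]. *)
Lemma barycenter_bound n (b : nat -> R) (w q : 'I_n -> V) t s : 0 <= c ->
  0 <= s -> wts b n -> (forall i l, nrm (w i - w l) <= t) ->
  (forall i, nrm (w i - q i) <= t) ->
  (forall i, s <= nrm (w i - \sum_(l < n) b l *: q l)) ->
  s ^+ 2 <= 2 * c * t ^+ 2.
Proof.
move=> c0 s0 [b0 b1] ww wq ws.
(* With this average displacement, [w i] minus the barycenter is the weighted mean of the vectors
   [a + (w i - w l)]. *)
pose a := \sum_(l < n) b l *: (w l - q l).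
pose f i l := nrm (a + (w i - w l)) ^+ 2.
have at_ : nrm a <= t.
  apply: (@le_trans _ _ (\sum_(l < n) b l * t)); last by rewrite -mulr_suml b1 mul1r.
  apply: (@le_trans _ _ (\sum_(l < n) nrm (b l *: (w l - q l)))).
    rewrite /a; elim/big_ind2: _ => [|x1 x2 y1 y2 h1 h2|//]; first by rewrite nrm0.
    by rewrite (le_trans (nrmD _ _))// lerD.
  by apply: ler_sum => l _; rewrite nrmZ ger0_norm// ler_wpM2l.
(* Exchanging [i] and [l] turns a + z into a - z, so that [nrm_nj] bounds the pair. *)
have fle i l : f i l + f l i <= 4 * c * t ^+ 2.
  have := nrm_nj a (w i - w l); rewrite opprB => h; apply: (le_trans h).
  have := ww i l; have := nrm_ge0 a; have := nrm_ge0 (w i - w l) => n1 n2 n3.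
  have : nrm a ^+ 2 <= t ^+ 2 by rewrite ler_sqr ?nnegrE// (le_trans n2).
  have : nrm (w i - w l) ^+ 2 <= t ^+ 2 by rewrite ler_sqr ?nnegrE// (le_trans n1).
  nra.
have fge i : s ^+ 2 <= \sum_(l < n) b l * f i l.
  have h : s <= \sum_(l < n) b l * nrm (a + (w i - w l)).
    apply: (le_trans (ws i)).
    have -> : w i - \sum_(l < n) b l *: q l = \sum_(l < n) b l *: (a + (w i - w l)).
      transitivity (\sum_(l < n) (b l *: (a + w i) - b l *: w l)); last first.
        by apply: eq_bigr => l _; rewrite -scalerBr addrA.
      rewrite big_split/= -scaler_suml b1 scale1r sumrN /a.
      transitivity (\sum_(l < n) (b l *: w l - b l *: q l) + w i -
          \sum_(l < n) b l *: w l); last first.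
        by congr (_ + _ - _); apply: eq_bigr => l _; rewrite scalerBr.
      rewrite big_split/= sumrN addrAC [X in _ = X + _]addrAC subrr add0r.
      by rewrite addrC.
    elim/big_ind2: _ => [|x1 x2 y1 y2 h1 h2|l _]; first by rewrite nrm0.
      by rewrite (le_trans (nrmD _ _))// lerD.
    by rewrite nrmZ ger0_norm.
  (* Jensen's inequality for the square, by its tangent at [s]. *)
  have : \sum_(l < n) b l * (2 * s * nrm (a + (w i - w l)) - s ^+ 2) <=
         \sum_(l < n) b l * f i l.
    apply: ler_sum => l _; apply: ler_wpM2l => //; rewrite /f.
    have := sqr_ge0 (nrm (a + (w i - w l)) - s); nra.
  apply: le_trans; under eq_bigr do rewrite mulrBr mulrCA.
  by rewrite sumrB -mulr_sumr -mulr_suml b1; nra.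
have h1 : s ^+ 2 <= \sum_(i < n) \sum_(l < n) b i * (b l * f i l).
  rewrite -[leLHS]mul1r -b1 mulr_suml; apply: ler_sum => i _.
  by rewrite -mulr_sumr ler_wpM2l.
have h2 : s ^+ 2 <= \sum_(i < n) \sum_(l < n) b i * (b l * f l i).
  rewrite exchange_big/=; apply: (le_trans h1); apply: ler_sum => i _.
  by apply: ler_sum => l _; rewrite mulrCA.
have : \sum_(i < n) \sum_(l < n) b i * (b l * f i l) +
    \sum_(i < n) \sum_(l < n) b i * (b l * f l i) <= 4 * c * t ^+ 2.
  rewrite -[leRHS]mul1r -{1}b1 mulr_suml -big_split; apply: ler_sum => i _ /=.
  rewrite -[4 * c * _]mul1r -{1}b1 mulr_suml mulr_sumr -big_split.
  apply: ler_sum => l _ /=; rewrite -!mulrDr; apply: ler_wpM2l => //.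
  exact: ler_wpM2l.
lra.
Qed.

End weighted.

Lemma In_map_enum (I : finType) (T : Type) (g : I -> T) i :
  List.In (g i) [seq g j | j <- enum I].
Proof.
have : i \in enum I by rewrite mem_enum.
by elim: (enum I) => //= j s IH; rewrite inE => /orP[/eqP->|/IH]; [left|right].
Qed.

(** * From approximate to exact common fixed points *)

Section family.
Variables (R : realType) (c : R) (V : njSpace c).
Variables (K0 : set V) (M : R) (A : Type) (S : A -> V -> V).
Hypotheses (dK0 : domain K0 M) (fS : nonexp_family K0 S).
Hypothesis afpF : forall F : seq A, exists k (g : 'I_k -> A),
  (forall a, List.In a F -> exists i, g i = a) /\ afp c k.

Record invariant (K : set V) : Prop := Invariant {
  inv_dom : domain K M;
  inv_sub : forall x, K x -> K0 x;
  inv_maps : forall a x, K x -> K (S a x) }.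

Definition good (F : seq A) (d : R) (x : V) :=
  forall a, List.In a F -> nrm (S a x - x) <= d.

(* [ev P]: [P] holds at all points that are fixed well enough. *)
Definition ev (P : V -> Prop) := exists F d, 0 < d /\
  forall x, K0 x -> good F d x -> P x.

Lemma evT (P : V -> Prop) : (forall x, K0 x -> P x) -> ev P.
Proof. by move=> h; exists [::], 1; split=> // x /h. Qed.

Lemma ev_mono (P Q : V -> Prop) : (forall x, K0 x -> P x -> Q x) -> ev P -> ev Q.
Proof.
move=> PQ [F [d [d0 h]]]; exists F, d; split => // x Kx /(h _ Kx).
exact: PQ.
Qed.

Lemma ev_and (P Q : V -> Prop) : ev P -> ev Q -> ev (fun x => P x /\ Q x).
Proof.
move=> [F [d [d0 hP]]] [G [e [e0 hQ]]]; exists (F ++ G), (Num.min d e).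
rewrite lt_min d0 e0; split => // x Kx h; split.
  apply: hP => // a aF; apply: (le_trans (h a _)); last by rewrite ge_min lexx.
  by apply: List.in_or_app; left.
apply: hQ => // a aF; apply: (le_trans (h a _)); last by rewrite ge_min lexx orbT.
by apply: List.in_or_app; right.
Qed.

Lemma ev_forall_lt (P : nat -> V -> Prop) n : (forall i, (i < n)%N -> ev (P i)) ->
  ev (fun x => forall i, (i < n)%N -> P i x).
Proof.
elim: n => [|n IH] h; first exact: evT.
apply: ev_mono (ev_and (IH (fun i j => h i (ltnW j))) (h n (ltnSn n))).
by move=> x _ [h1 h2] i; rewrite ltnS leq_eqVlt => /orP[/eqP->//|]; exact: h1.
Qed.

Lemma ev_forall_seq (P : V -> V -> Prop) (L : seq V) : (forall l, l \in L -> ev (P l)) ->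
  ev (fun x => forall l, l \in L -> P l x).
Proof.
elim: L => [|l L IH] h; first by apply: evT.
have hL k : k \in L -> ev (P k) by move=> kL; apply: h; rewrite inE kL orbT.
apply: ev_mono (ev_and (IH hL) (h l (mem_head _ _))).
by move=> x _ [h1 h2] k; rewrite inE => /orP[/eqP->//|]; exact: h1.
Qed.

Lemma ev_good a d : 0 < d -> ev (fun x => nrm (S a x - x) <= d).
Proof. by move=> d0; exists [:: a], d; split=> // x _; apply; left. Qed.

(** A condition in [ev] involves finitely many maps, and these have almost fixed points inside [K]
    by [afpF]. *)
Lemma ev_ex K P : invariant K -> ev P -> exists2 x, K x & P x.
Proof.
move=> [dK KK0 mK] [F [d [d0 h]]]; have [k [g [hg af]]] := afpF F.
have [x Kx hx] : exists2 x, K x & forall i, nrm ((S \o g) i x - x) <= d.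
  by apply: (af _ _ M) => //; apply: (sub_family fS) => // j x; exact: mK.
exists x => //; apply: h; first exact: KK0.
by move=> a /hg[i <-]; exact: hx.
Qed.

Section perturb.
Variables (K : set V) (m : nat).
Hypothesis iK : invariant K.

Section ultra.
Variables (k : nat) (g : 'I_k -> A) (q v : nat -> 'I_m -> V).
Hypotheses (afpk : afp c k) (qK : forall n i, K (q n i)).
Hypotheses (vK : forall n i, K (v n i)).
Hypothesis qgood : forall n i j, nrm (S (g j) (q n i) - q n i) <= n.+1%:R^-1.

Let E := upow (tup V m).

Let W : set E := fun w => (forall n i, K (w n i)) /\ forall e : R, 0 < e ->
  U (fun n => forall i l, nrm (w n i - w n l) <= nrm (v n i - v n l) + e /\
                          nrm (w n i - q n l) <= nrm (v n i - q n l) + e).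

Let M' := Num.sqrt (\sum_(i < m) M ^+ 2).

Let bound (x : tup V m) : (forall i, K (x i)) -> nrm x <= M'.
Proof.
by move=> h; apply: nrm_tup_bound => i; apply: (dom_bound (inv_dom iK)).
Qed.

Let mk (f : nat -> 'I_m -> V) : E :=
  mkU (fun n => [ffun i => f n i] : tup V m).

Let mkE f n i : (forall n i, K (f n i)) -> mk f n i = f n i.
Proof.
move=> fK; rewrite (mkUE (M := M')) ?ffunE// => p; apply: bound => j.
by rewrite ffunE.
Qed.

Let domW : domain W M'.
Proof.
have vE n i : mk v n i = v n i by exact: mkE.
split.
- exists (mk v); split => [n i|e e0].
    by rewrite vE.
  by apply: U_all => n i l; rewrite !vE !lerDl ltW.
- move=> t w w' t01 [Kw hw] [Kw' hw'].
  have tE n i : (t *: w + (1 - t) *: w' : E) n i = t *: w n i + (1 - t) *: w' n i.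
    by rewrite uvalD !uvalZ !ffunE.
  split=> [n i|e e0].
    by rewrite tE; exact: (dom_convex (inv_dom iK)).
  apply: U_mono (U_and (hw e e0) (hw' e e0)) => n [h h'] i l; rewrite !tE.
  have /andP[t0 t1] := t01.
  have [h1 h2] := h i l; have [h1' h2'] := h' i l; split; last first.
    apply: (le_trans (nrm_convB _ _ _ t01)); nra.
  rewrite opprD addrACA -!scalerBr; apply: (le_trans (nrm_conv _ _ t01)); nra.
- move=> u Wu cu.
  have ub j n : nrm (u j n) <= M' by apply: bound => i; exact: (Wu j).1.
  have [x hx ux] := upow_complete ub cu; exists x => //; split=> [n i|e e0].
    by have [j ->] := hx n; exact: (Wu j).1.
  have e40 : 0 < e / 4 by rewrite divr_gt0.
  have [N /(_ N (leqnn N)) hN] := ux _ e40.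
  have : nrm (u N - x) < e / 3 by lra.
  move=> /unrm_lt hU; apply: U_mono (U_and hU ((Wu N).2 _ e40)) => n [h1 h2] i l.
  have hi j : nrm (u N n j - x n j) < e / 3.
    apply: le_lt_trans h1; have := nrm_tup_ge ((u N - x : E) n) j.
    by rewrite uvalD uvalN !ffunE.
  have [h3 h4] := h2 i l; have hii := hi i; have hil := hi l; split.
    have := nrm_tri (u N n i) (x n i) (x n l).
    have := nrm_tri (u N n l) (u N n i) (x n l); rewrite [nrm (x n i - u N n i)]nrmC.
    lra.
  have := nrm_tri (u N n i) (x n i) (q n l); rewrite [nrm (x n i - u N n i)]nrmC.
  lra.
- by move=> w [Kw _]; apply: unrm_le; apply: U_all => n; exact: bound.
Qed.

Let T (j : 'I_k) (w : E) : E := mk (fun n i => S (g j) (w n i)).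

Let TE j w n i : W w -> T j w n i = S (g j) (w n i).
Proof.
by move=> [Kw _]; apply: mkE => p l; exact: (inv_maps iK).
Qed.

Let ne j x y : K x -> K y -> nrm (S (g j) x - S (g j) y) <= nrm (x - y).
Proof. by move=> /(inv_sub iK) Kx /(inv_sub iK) Ky; exact: (fam_nonexp fS). Qed.

Let famW : nonexp_family W T.
Proof.
have mT j w : W w -> W (T j w).
  move=> Ww; have [Kw hw] := Ww; split=> [n i|e e0].
    by rewrite TE//; exact: (inv_maps iK).
  have e20 : 0 < e / 2 by rewrite divr_gt0.
  (* Beyond [N] the points [q n l] move by less than e / 2, so comparing with their images costs
     only that much. *)
  have [N hN] := archi_inv e20.
  apply: U_mono (U_and (U_ge N) (hw _ e20)) => n [Nn h] i l; rewrite !TE//.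
  have [h1 h2] := h i l; split.
    by apply: (le_trans (ne _ _ _)) => //; lra.
  apply: (le_trans (nrm_tri (S (g j) (q n l)) _ _)).
  have := ne j (Kw n i) (qK n l); have := qgood n l j.
  have : n.+1%:R^-1 <= N.+1%:R^-1 :> R by rewrite lef_pV2 ?posrE// ler_nat.
  by move: (n.+1%:R^-1) (N.+1%:R^-1) hN => a b; lra.
split; first exact: mT.
- move=> j w w' Ww Ww'; apply: ulim_mono; [exact: uvalP..|move=> n].
  apply: nrm_tup_le => i; rewrite !uvalD !uvalN !ffunE !TE//.
  by apply: ne; [exact: Ww.1|exact: Ww'.1].
- move=> i j w Ww; rewrite {1}/T [RHS]/T /mk; congr mkU; apply/funext => n.
  apply/ffunP => l; rewrite !ffunE !TE//; apply: (fam_comm fS).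
  exact: (inv_sub iK (Ww.1 n l)).
Qed.

Lemma perturb_ultra d e : 0 < d -> 0 < e -> exists n (w : 'I_m -> V),
  forall i, [/\ K (w i), forall j, nrm (S (g j) (w i) - w i) <= d &
   forall l, nrm (w i - w l) <= nrm (v n i - v n l) + e /\
             nrm (w i - q n l) <= nrm (v n i - q n l) + e].
Proof.
move=> d0 e0; have d20 : 0 < d / 2 by rewrite divr_gt0.
have [w Ww hw] := afpk domW famW d20.
have h : U (fun n => forall j, nrm ((T j w - w : E) n) < d).
  apply: filter_forall => j; apply: unrm_lt.
  by rewrite (le_lt_trans (hw j))// gtr_pMr// invf_lt1// ltr1n.
have [n [h1 h2]] := U_ex (U_and h (Ww.2 e e0)).
exists n, (w n) => i; split; first exact: Ww.1.
- move=> j; apply/ltW; apply: le_lt_trans (h1 j).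
  have := nrm_tup_ge ((T j w - w : E) n) i.
  by rewrite uvalD uvalN !ffunE TE.
- by move=> l; exact: h2.
Qed.
End ultra.

(* If the [q i] are fixed well enough, then [v] can be replaced by a tuple of
   well fixed points, essentially without increasing its mutual distances and
   its distances to the [q i]: in the ultrapower of [tup V m], where the [q i]
   become fixed, the tuples that are as close as [v] form an invariant set. *)
Lemma perturb (P : V -> Prop) e : ev P -> 0 < e -> exists Q, ev Q /\
  forall q v : 'I_m -> V, (forall i, K (q i) /\ Q (q i)) -> (forall i, K (v i)) ->
  exists w : 'I_m -> V, forall i, [/\ K (w i), P (w i) &
   forall l, nrm (w i - w l) <= nrm (v i - v l) + e /\
             nrm (w i - q l) <= nrm (v i - q l) + e].
Proof.
move=> [F [d [d0 hP]]] e0; have [k [g [hg afk]]] := afpF F.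
pose Q n x := forall j, nrm (S (g j) x - x) <= n.+1%:R^-1.
have evQ n : ev (Q n).
  exists [seq g j | j <- enum 'I_k], n.+1%:R^-1; split; first by rewrite invr_gt0.
  by move=> x _ h j; apply: h; exact: In_map_enum.
apply: contrapT => H.
have H1 n : exists qv : ('I_m -> V) * ('I_m -> V),
   [/\ forall i, K (qv.1 i), forall i, Q n (qv.1 i), forall i, K (qv.2 i) &
   ~ exists w : 'I_m -> V, forall i, [/\ K (w i), P (w i) &
   forall l, nrm (w i - w l) <= nrm (qv.2 i - qv.2 l) + e /\
             nrm (w i - qv.1 l) <= nrm (qv.2 i - qv.1 l) + e]].
  apply: contrapT => h; apply: H; exists (Q n); split => // q v hq hv.
  apply: contrapT => h2; apply: h; exists (q, v).
  by split => //= i; have [] := hq i.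
have [qv /all_and4[h1 h2 h3 h4]] := choice H1.
have [n [w hw]] := perturb_ultra (q := fun n => (qv n).1) (v := fun n => (qv n).2)
  afk h1 h3 (fun n i j => h2 n i j) d0 e0.
apply: (h4 n); exists w => i; have [Kw Sw dw] := hw i; split => //.
apply: hP; first exact: (inv_sub iK).
by move=> a /hg[j <-]; exact: Sw.
Qed.

End perturb.
Definition low (K : set V) (s : R) :=
  forall y, K y -> ev (fun x => K x -> s <= nrm (x - y)).

(** Failure of [low] gives a center [y] with arbitrarily well fixed points of [K] closer than [r];
    these form [X]. The points whose asymptotic distance to [X] is at most [r] form [L], which
    contains [y] and is invariant because the maps are nonexpansive and hardly move well fixed
    points of [X]. *)
Lemma shrink K r : invariant K -> ~ low K r -> exists X L : set V,
  [/\ invariant L, forall x, L x -> K x, forall x, X x -> K x,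
      forall P, ev P -> exists2 x, X x & P x &
      forall v, L v -> forall e, 0 < e -> ev (fun x => X x -> nrm (x - v) <= r + e)].
Proof.
move=> iK nlow.
have [y [Ky hy]] : exists y, K y /\ ~ ev (fun x => K x -> r <= nrm (x - y)).
  apply: contrapT => h; apply: nlow => y Ky; apply: contrapT => h2; apply: h.
  by exists y.
pose X : set V := fun x => K x /\ nrm (x - y) < r.
have Xfreq P : ev P -> exists2 x, X x & P x.
  move=> evP; apply: contrapT => h; apply: hy; apply: ev_mono evP => x _ Px Kx.
  by rewrite leNgt; apply/negP => xy; apply: h; exists x.
pose L : set V := fun v => K v /\
  forall e, 0 < e -> ev (fun x => X x -> nrm (x - v) <= r + e).
exists X, L; split => //; last by move=> v [].
- split.
  + apply: (sub_domain (inv_dom iK)); first by move=> x [].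
    * exists y; split => // e e0; apply: evT => x _ [_ xy].
      by rewrite ltW// (lt_le_trans xy)// lerDl ltW.
    * move=> t v w t01 [Kv hv] [Kw hw]; split; first exact: (dom_convex (inv_dom iK)).
      move=> e e0; apply: ev_mono (ev_and (hv e e0) (hw e e0)) => x _ [h1 h2] Xx.
      rewrite nrmC; apply: (le_trans (nrm_convB _ _ _ t01)).
      have := h1 Xx; have := h2 Xx; have /andP[t0 t1] := t01.
      rewrite [nrm (x - v)]nrmC [nrm (x - w)]nrmC; nra.
    * move=> u v Lu Kv uv; split => // e e0.
      have e20 : 0 < e / 2 by rewrite divr_gt0.
      have [N /(_ N (leqnn N)) hN] := uv _ e20.
      apply: ev_mono ((Lu N).2 _ e20) => x _ h Xx; have {}h := h Xx.
      by apply: (le_trans (nrm_tri (u N) _ _)); lra.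
  + by move=> x [Kx _]; exact: (inv_sub iK).
  + move=> a v [Kv hv]; split; first exact: (inv_maps iK).
    move=> e e0; have e20 : 0 < e / 2 by rewrite divr_gt0.
    apply: ev_mono (ev_and (hv _ e20) (ev_good a e20)) => x K0x [h1 h2] Xx.
    have {}h1 := h1 Xx; apply: (le_trans (nrm_tri (S a x) _ _)).
    have := fam_nonexp fS a K0x (inv_sub iK Kv); rewrite nrmC in h2; lra.
- by move=> x [].
- by move=> x [].
Qed.

Lemma shrink_diam K e : invariant K -> (forall s, 0 < s -> ~ low K s) -> 0 < e ->
  exists L, [/\ invariant L, forall x, L x -> K x &
    forall v w, L v -> L w -> nrm (v - w) <= e].
Proof.
move=> iK nlow e0; have e40 : 0 < e / 4 by rewrite divr_gt0.
have [X [L [iL LK _ Xf hL]]] := shrink iK (nlow _ e40).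
exists L; split => // v w Lv Lw.
have [x Xx [h1 h2]] := Xf _ (ev_and (hL v Lv _ e40) (hL w Lw _ e40)).
by have := nrm_tri x v w; have := h1 Xx; have := h2 Xx; rewrite (nrmC v x); lra.
Qed.

(** Cantor's intersection argument: nested invariant sets with diameters tending to 0 determine a
    point, and the maps move points deep in the sequence only within a small set. *)
Lemma shrinking_fixed : (forall K, invariant K -> forall s, 0 < s -> ~ low K s) ->
  exists2 x, K0 x & forall a, nrm (S a x - x) = 0.
Proof.
move=> nlow.
have step p : exists L : set V, invariant p.2 -> [/\ invariant L,
    forall x, L x -> p.2 x & forall v w, L v -> L w -> nrm (v - w) <= p.1.+1%:R^-1].
  have [i2|n2] := pselect (invariant p.2); last by exists p.2.
  have p0 : 0 < p.1.+1%:R^-1 :> R by rewrite invr_gt0.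
  by have [L hL] := shrink_diam i2 (nlow _ i2) p0; exists L.
have [G hG] := choice step.
have i0 : invariant K0 by split => // a x; exact: (fam_maps fS).
pose Kn := fix Kn n := if n is n'.+1 then G (n', Kn n') else K0.
have iKn n : invariant (Kn n) by elim: n => //= n /(hG (n, Kn n))[].
have sub n m x : (n <= m)%N -> Kn m x -> Kn n x.
  move=> /subnK <-; elim: (m - n)%N => // k IH.
  by rewrite addSn /= => /((let: And3 _ h _ := hG (_, _) (iKn _) in h) _)/IH.
have diam n v w : Kn n.+1 v -> Kn n.+1 w -> nrm (v - w) <= n.+1%:R^-1.
  by have [_ _] := hG (n, Kn n) (iKn n); apply.
have ex n : exists x, Kn n.+1 x := dom_ex (inv_dom (iKn n.+1)).
have [x hx] := choice ex.
have xm n m : (n <= m)%N -> Kn n.+1 (x m) by move=> nm; exact: (sub n.+1 m.+1).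
have [] := dom_complete dK0 (u := x).
- by move=> n; exact: (sub 0 n.+1).
- move=> e /archi_inv[N hN]; exists N => m n Nm Nn.
  by apply: (le_trans _ (ltW hN)); apply: diam; exact: xm.
move=> z Kz xz; exists z => // a; apply/le_anti; rewrite nrm_ge0 andbT.
apply/ler_addgt0Pr => e e0; rewrite add0r; have e60 : 0 < e / 6 by rewrite divr_gt0.
have [N1 hN1] := xz _ e60; have [N2 hN2] := archi_inv e60.
pose n := maxn N1 N2.
have h1 := hN1 n (leq_maxl _ _).
have h2 : nrm (S a (x n) - x n) <= e / 6.
  apply: (le_trans _ (ltW hN2)); apply: (diam N2); last exact: xm (leq_maxr _ _).
  by apply: (inv_maps (iKn N2.+1)); exact: xm (leq_maxr _ _).
have := fam_nonexp fS a Kz (inv_sub (iKn n.+1) (hx n)); rewrite [nrm (z - _)]nrmC.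
have := nrm_tri (S a (x n)) (S a z) z; have := nrm_tri (x n) (S a (x n)) z; lra.
Qed.

(* [Req] allows the demands on each point of the chain to depend on the
   preceding ones. The point added last is chosen in the largest set. *)
Lemma chain r e : 0 < r -> 0 < e -> (forall K, invariant K -> ~ low K r) ->
  forall N K (Req : seq V -> V -> Prop), invariant K -> (forall l, ev (Req l)) ->
  exists q : seq V, [/\ size q = N, forall i, (i < N)%N -> K (nth 0 q i),
    forall i j, (i < N)%N -> (j < N)%N -> nrm (nth 0 q i - nth 0 q j) <= r + e &
    forall i j, (j <= i < N)%N -> Req (take j q) (nth 0 q i)].
Proof.
move=> r0 e0 nlow; elim=> [|N IH] K Req iK evR.
  by exists [::]; split => // i j; rewrite andbC.
(* The first [N] points are built inside [L], so that a sufficiently well fixed point of [X] is near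
   all of them. *)
have [X [L [iL LK XK Xf hL]]] := shrink iK (nlow _ iK).
have [q [sq qL qd qR]] := IH L Req iL evR.
have E : ev (fun x => (forall i, (i < N)%N -> X x -> nrm (x - nth 0 q i) <= r + e) /\
    forall j, (j < N.+1)%N -> Req (take j q) x).
  apply: ev_and; apply: ev_forall_lt => i iN; last exact: evR.
  by apply: hL => //; exact: qL.
have [x Xx [h1 h2]] := Xf _ E.
have nthE i : (i < N)%N -> nth 0 (rcons q x) i = nth 0 q i.
  by move=> iN; rewrite nth_rcons sq iN.
have nthN : nth 0 (rcons q x) N = x by rewrite nth_rcons sq ltnn eqxx.
exists (rcons q x); split; first by rewrite size_rcons sq.
- move=> i; rewrite ltnS leq_eqVlt => /orP[/eqP->|iN]; first by rewrite nthN; exact: XK.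
  by rewrite nthE//; apply/LK/qL.
- move=> i j; rewrite !ltnS (leq_eqVlt i) (leq_eqVlt j) => /orP[/eqP->|iN] /orP[/eqP->|jN].
  + by rewrite subrr nrm0 addr_ge0 ?ltW.
  + by rewrite nthN nthE//; exact: h1.
  + by rewrite nthN nthE// nrmC; exact: h1.
  + by rewrite !nthE//; exact: qd.
- move=> i j /andP[ji]; rewrite ltnS => iN.
  have -> : take j (rcons q x) = take j q.
    by rewrite -cats1 takel_cat// sq (leq_trans ji).
  move: iN; rewrite leq_eqVlt => /orP[/eqP iN|iN]; last first.
    by rewrite nthE//; apply: qR; rewrite ji.
  by rewrite iN nthN; apply: h2; rewrite -iN ltnS.
Qed.

Hypothesis c12 : 1 < c < 2.

(** Supplies the data of [barycenter_bound]: late chain points [qq], perturbed midpoints [w] with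
    mutual distances about r / 2, and distance about [s] from [w] to the early combination [y],
    hence to the late one [z]. *)
Lemma separation_bound K s r e : invariant K -> low K s -> 0 < e -> 0 < r ->
  2 * e <= s -> (forall L, invariant L -> ~ low L r) ->
  (s - 2 * e) ^+ 2 <= c / 2 * (r + 3 * e) ^+ 2.
Proof.
move=> iK lowK e0 r0 es nlow.
have [N hN] := james c12 V M e0.
(* The point [x] stays almost [s] away from the whole hull of [l]; the loss [e] comes from a finite
   net of the hull. *)
pose P (l : seq V) x := (forall i, (i < size l)%N -> K (nth 0 l i)) -> K x ->
  forall a, wts a (size l) -> s - e <= nrm (x - \sum_(i < size l) a i *: nth 0 l i).
have evP l : ev (P l).
  have [lK|nK] := pselect (forall i, (i < size l)%N -> K (nth 0 l i)); last first.
    by apply: evT => x _ lK; case: nK.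
  have [H [HK hH]] := hull_totally_bounded (dom_convex (inv_dom iK))
    (dom_bound (inv_dom iK)) lK e0.
  have E : ev (fun x => forall h, h \in H -> K x -> s <= nrm (x - h)).
    by apply: ev_forall_seq => h /HK /lowK.
  apply: ev_mono E => x _ hx _ Kx a /hH[h hh ha]; have := hx h hh Kx.
  have := nrm_tri (\sum_(i < size l) a i *: nth 0 l i) x h; lra.
(* The number m of late points is known only once James's theorem has been applied to the finished
   chain, so the chain must meet the demand for every m up to [N]. *)
have [Q hQ] := choice (fun p : seq V * nat => perturb p.2 iK (evP p.1) e0).
have evR l : ev (fun x => forall m, (m < N.+1)%N -> Q (l, m) x).
  by apply: ev_forall_lt => m _; exact: (hQ (l, m)).1.
have [q [sq qK qd qR]] := chain r0 e0 nlow N iK evR.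
have qM i : nrm (nth 0 q i) <= M.
  have [iN|iN] := ltnP i N; first by apply: (dom_bound (inv_dom iK)); exact: qK.
  rewrite nth_default ?sq// nrm0; have [x Kx] := dom_ex (inv_dom iK).
  exact: le_trans (nrm_ge0 x) (dom_bound (inv_dom iK) Kx).
have [j [m [a [b [jm wa wb hab]]]]] := hN _ qM.
set y := \sum_(i < j) _ in hab; set z := \sum_(i < m) _ in hab.
have jN : (j <= N)%N := leq_trans (leq_addr _ _) jm.
have mN : (m < N.+1)%N by rewrite ltnS (leq_trans (leq_addl _ _) jm).
have lt1 i : (i < j)%N -> (i < N)%N by move=> ij; exact: leq_trans jN.
have lt2 (i : 'I_m) : (j + i < N)%N by rewrite (leq_trans _ jm)// ltn_add2l.
have Ky : K y.
  apply: (convex_sum (q := nth 0 q) (dom_convex (inv_dom iK)) wa) => i ij.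
  exact/qK/lt1.
pose qq (i : 'I_m) := nth 0 q (j + i).
pose v (i : 'I_m) := 2^-1 *: qq i + 2^-1 *: y.
have qqK i : K (qq i) by exact: qK.
have yq i : nrm (y - qq i) <= r + e.
  apply: (nrm_wsum (q := nth 0 q) wa) => p pj; apply: qd => //; exact: lt1.
have [|i|w hw] := (hQ (take j q, m)).2 qq v.
- by move=> i; split => //; apply: qR => //; rewrite leq_addr lt2.
- by apply: convex_half => //; exact: (dom_convex (inv_dom iK)).
have stj : size (take j q) = j by rewrite size_takel// sq.
have wy i : s - e <= nrm (w i - y).
  have [Kw Pw _] := hw i; have := Pw _ Kw a.
  have -> : \sum_(p < size (take j q)) a p *: nth 0 (take j q) p = y.
    by rewrite stj; apply: eq_bigr => p _; rewrite nth_take.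
  rewrite stj; apply => // p pj; rewrite nth_take//; exact/qK/lt1.
have hh : 2^-1 * (r + e) + e = (r + 3 * e) / 2 by field.
have vq i l : nrm (v i - v l) <= 2^-1 * (r + e).
  rewrite /v opprD addrACA subrr addr0 -scalerBr nrmZ ger0_norm ?invr_ge0// ler_wpM2l ?invr_ge0//.
  by apply: qd; exact: lt2.
have vqq i : nrm (v i - qq i) <= 2^-1 * (r + e).
  apply: (le_trans (nrm_half _ _ _)); rewrite subrr nrm0 mulr0 add0r.
  by rewrite ler_wpM2l ?invr_ge0.
have := @barycenter_bound _ _ V m b w qq ((r + 3 * e) / 2) (s - 2 * e).
rewrite exprMn (_ : 2 * c * _ = c / 2 * (r + 3 * e) ^+ 2); last by field.
apply => //.
- by have /andP[] := c12; lra.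
- by rewrite subr_ge0.
- by move=> i l; have [_ _ /(_ l)[h _]] := hw i; rewrite -hh (le_trans h)// lerD2r.
- by move=> i; have [_ _ /(_ i)[_ h]] := hw i; rewrite -hh (le_trans h)// lerD2r.
- move=> i; have := wy i; have := nrm_tri z (w i) y; rewrite (nrmC z y).
  rewrite /z; lra.
Qed.

(** Without a fixed point, [shrinking_fixed] makes the supremum [t] positive; [separation_bound]
    just below and just above [t] then reads t^2 <= (c / 2) t^2 up to small errors. *)
Lemma common_fixed : exists2 x, K0 x & forall a, nrm (S a x - x) = 0.
Proof.
apply: contrapT => nfix.
have i0 : invariant K0 by split => // a x; exact: (fam_maps fS).
pose E : set R := fun s => 0 < s /\ exists2 K, invariant K & low K s.
have [s0 [s0p [K1 iK1 lowK1]]] : exists s, E s.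
  apply: contrapT => h; apply: nfix; apply: shrinking_fixed => K iK s sp lowK.
  by apply: h; exists s; split => //; exists K.
have ubE : ubound E (2 * M).
  move=> s [_ [K iK lowK]]; have [y Ky] := dom_ex (inv_dom iK).
  have [x Kx h] := ev_ex iK (lowK y Ky).
  rewrite (le_trans (h Kx))// (le_trans (nrmB _ _))//.
  have := dom_bound (inv_dom iK) Kx; have := dom_bound (inv_dom iK) Ky; lra.
have supE : has_sup E by split; [exists s0; split => //; exists K1|exists (2 * M)].
pose t := sup E.
have t0 : 0 < t.
  by apply: (lt_le_trans s0p); apply: ub_le_sup; [exact: supE.2|split=> //; exists K1].
have /andP[c1 c2] := c12.
(* Then c / 2 = 1 - 50 h, a gap that the errors, of size 3 h and 4 h relative to [t], cannot
   fill. *)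
pose h := (2 - c) / 100; pose e := t * h.
have h0 : 0 < h by rewrite divr_gt0// subr_gt0.
have e0 : 0 < e by rewrite mulr_gt0.
have [s [sp [K iK lowK]] hs] := sup_adherent e0 supE.
have nlow L : invariant L -> ~ low L (t + e).
  move=> iL lowL; have : t + e <= t.
    by apply: ub_le_sup; [exact: supE.2|split; [rewrite addr_gt0|exists L]].
  by rewrite gerDl leNgt e0.
rewrite -/t in hs.
have h1 : h <= 1 / 100 by rewrite /h; lra.
have te : 0 < t + e by rewrite addr_gt0.
have es : 2 * e <= s by rewrite /e in hs *; nra.
have := separation_bound iK lowK e0 te es nlow.
have ht3 : t * (1 - 3 * h) <= s - 2 * e by rewrite /e in hs *; lra.
have : (t * (1 - 3 * h)) ^+ 2 <= (s - 2 * e) ^+ 2.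
  by rewrite ler_sqr ?nnegrE ?subr_ge0//; apply: mulr_ge0; lra.
have -> : t + e + 3 * e = t * (1 + 4 * h) by rewrite /e; ring.
have -> : c / 2 = 1 - 50 * h by rewrite /h; field.
move=> a1 a2; have := le_trans a1 a2.
have : t ^+ 2 * ((1 - 50 * h) * (1 + 4 * h) ^+ 2) < t ^+ 2 * (1 - 3 * h) ^+ 2.
  by rewrite ltr_pM2l ?exprn_gt0//; nra.
lra.
Qed.

End family.

(** * Induction on the number of maps, then arbitrary families *)

Section fpp.
Variables (R : realType) (c : R).
Hypothesis c12 : 1 < c < 2.

(** Fixed points of k maps give almost fixed points of k + 1 maps by [afpS], and [common_fixed]
    makes these exact. *)
Lemma fpp_all k : fpp c k.
Proof.
elim: k => [|k IH]; first exact: fpp0.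
move=> V K M S dK fS; apply: (common_fixed dK fS _ c12) => F.
by exists k.+1, id; split; [move=> a _; exists a|exact: afpS].
Qed.

(** [common_fixed] asks for almost fixed points of finite subfamilies only, and [fpp_all] provides
    them. *)
Lemma fpp_infinite (V : njSpace c) (K : set V) M (A : Type) (S : A -> V -> V) :
  domain K M -> nonexp_family K S ->
  exists2 x, K x & forall a, nrm (S a x - x) = 0.
Proof.
move=> dK fS; apply: (common_fixed dK fS _ c12) => F.
exists (size F), (tnth (in_tuple F)); split.
  move=> a; rewrite -[F in List.In a F]/(val (in_tuple F)) => aF.
  have [i iF <-] : exists2 i, (i < size F)%N & nth a F i = a.
    elim: F aF => //= b F IH [->|/IH[i iF ia]]; first by exists 0%N.
    by exists i.+1.
  by exists (Ordinal iF); rewrite (tnth_nth a).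
case: (size F) => [|k]; last by apply/afpS/fpp_all.
move=> V' K' M' S' dK' fS' d d0; have [x Kx hx] := fpp0 dK' fS'.
by exists x => // -[].
Qed.

End fpp.

(** * From uniform nonsquareness to the von Neumann-Jordan inequality *)

Section nonsquare.
Variables (R : realType) (X : normedModType R).
Hypothesis hX : uniformly_nonsquare X.

Lemma nonsquare_gap : exists2 d : R, 0 < d <= 1 &
  forall x y : X, `|x| = 1 -> `|y| = 1 -> Num.min `|x + y| `|x - y| <= 2 - d.
Proof.
have ub (x y : X) : `|x| = 1 -> `|y| = 1 -> ((Num.min `|x + y| `|x - y|)%:E <=
    ereal_sup [set (Num.min `|x + y| `|x - y|)%:E
             | x in @unit_sphere R X & y in @unit_sphere R X])%E.
  by move=> hx hy; apply: ereal_sup_ubound; exists x => //; exists y.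
move: hX ub; rewrite /uniformly_nonsquare; case: ereal_sup => [r| |] //.
- rewrite lte_fin => r2 h; exists (Num.min 1 (2 - r)).
    by rewrite lt_min ltr01 subr_gt0 r2 ge_min lexx.
  move=> x y hx hy; have := h x y hx hy; rewrite lee_fin => /le_trans; apply.
  by rewrite lerBrDr -lerBrDl ge_min lexx orbT.
(* The supremum is -oo exactly when the unit sphere is empty, and the gap holds vacuously. *)
- move=> _ h; exists 1; first by rewrite ltr01 lexx.
  by move=> x y hx hy; have := h x y hx hy.
Qed.

(** For |y| <= |x|, splitting x = (|x| - |y|) u + |y| u carries the gap of the unit vectors u, v
    over to one of x + y and x - y; the other one is bounded by |x| + |y|. *)
Lemma nonsquare_nj : exists2 c : R, 1 < c < 2 & forall x y : X,
  `|x + y| ^+ 2 + `|x - y| ^+ 2 <= 2 * c * (`|x| ^+ 2 + `|y| ^+ 2).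
Proof.
have [d /andP[d0 d1] hd] := nonsquare_gap.
exists (2 - d / 4); first by apply/andP; split; lra.
suff main (x y : X) : `|y| <= `|x| ->
    `|x + y| ^+ 2 + `|x - y| ^+ 2 <= 2 * (2 - d / 4) * (`|x| ^+ 2 + `|y| ^+ 2).
  move=> x y; have [yx|/ltW xy] := leP `|y| `|x|; first exact: main.
  by rewrite addrC distrC (addrC x) [leRHS]mulrC (addrC (`|x| ^+ 2)) mulrC addrC main.
have [->|y0] := eqVneq y 0.
  by rewrite addr0 subr0 normr0; have := sqr_ge0 `|x|; nra.
have ny : 0 < `|y| by rewrite normr_gt0.
move=> yx; have nx : 0 < `|x| := lt_le_trans ny yx.
pose u := `|x|^-1 *: x; pose v := `|y|^-1 *: y.
have u1 : `|u| = 1 by rewrite normrZ ger0_norm ?invr_ge0// mulVf// gt_eqF.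
have v1 : `|v| = 1 by rewrite normrZ ger0_norm ?invr_ge0// mulVf// gt_eqF.
have xE : x = `|x| *: u by rewrite scalerA mulfV ?scale1r// gt_eqF.
have yE : y = `|y| *: v by rewrite scalerA mulfV ?scale1r// gt_eqF.
move: u v u1 v1 xE yE => u v u1 v1 xE yE.
have tri (s : R) : `|s| = 1 -> `|x + s *: y| <= (`|x| - `|y|) + `|y| * `|u + s *: v|.
  move=> s1; have -> : x + s *: y = (`|x| - `|y|) *: u + `|y| *: (u + s *: v).
    rewrite scalerDr addrA -scalerDl subrK -xE; congr (_ + _).
    by rewrite scalerA mulrC -scalerA -yE.
  rewrite (le_trans (ler_normD _ _))// !normrZ u1 mulr1 normr_id.
  by rewrite ger0_norm// subr_ge0.
have t1 := tri 1 (normr1 _); have t2 := tri (- 1) (etrans (normrN1 _) erefl).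
rewrite !scale1r in t1; rewrite !scaleN1r in t2.
have b1 := ler_normD x y; have b2 := ler_normB x y.
have n1 := normr_ge0 (x + y); have n2 := normr_ge0 (x - y).
have : Num.min `|u + v| `|u - v| <= 2 - d := hd _ _ u1 v1.
have arith (p q : R) : 0 <= p -> 0 <= q -> p <= `|x| + `|y| ->
    q <= (`|x| - `|y|) + `|y| * (2 - d) ->
    p ^+ 2 + q ^+ 2 <= 2 * (2 - d / 4) * (`|x| ^+ 2 + `|y| ^+ 2).
  move: (`|x|) (`|y|) nx ny yx => a b a0 b0 ba p0 q0 hp hq.
  have h1 : p ^+ 2 <= (a + b) ^+ 2 by rewrite ler_sqr ?nnegrE//; lra.
  have h2 : q ^+ 2 <= ((a - b) + b * (2 - d)) ^+ 2.
    by rewrite ler_sqr ?nnegrE//; exact: le_trans hq.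
  have h3 : (a + b) ^+ 2 + ((a - b) + b * (2 - d)) ^+ 2 <=
     4 * (a ^+ 2 + b ^+ 2) - 2 * (a - b) ^+ 2 - d * (b * (a + b)).
    have : 0 <= d * b * ((a + b) - d * b).
      by apply: mulr_ge0; [rewrite mulr_ge0 ?ltW|nra].
    nra.
  (* Norms far apart are handled by (a - b)^2, nearly equal ones by d b (a + b); this fixes the loss
     d / 4 in the constant. *)
  have h4 : d / 2 * (a ^+ 2 + b ^+ 2) <= 2 * (a - b) ^+ 2 + d * (b * (a + b)).
    have s0 := sqr_ge0 (a - b).
    have : d * (a - b) ^+ 2 <= 2 * (a - b) ^+ 2 by rewrite ler_wpM2r//; lra.
    have : 0 <= d * (2^-1 * (a - b) ^+ 2 + b ^+ 2).
      by have := sqr_ge0 b; nra.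
    nra.
  lra.
rewrite ge_min => /orP[h|h].
  rewrite addrC; apply: arith => //; apply: (le_trans t1); rewrite lerD2l.
  by rewrite ler_wpM2l.
by apply: arith => //; apply: (le_trans t2); rewrite lerD2l ler_wpM2l.
Qed.

End nonsquare.

(** * Asymptotically nonexpansive maps *)

Section intermediate.
Variables (R : realType) (X : completeNormedModType R) (C : set X) (T : X -> X).
Hypothesis hT : asymptotically_nonexpansive_intermediate C T.

Lemma intermediate_maps k x : C x -> C (iter k T x).
Proof. by have [CT _ _] := hT => Cx; elim: k => //= k; exact: CT. Qed.

Lemma intermediate_eps (e : R) : 0 < e -> exists N, forall n, (N <= n)%N ->
  forall x y, C x -> C y -> `|iter n T x - iter n T y| <= `|x - y| + e.
Proof.
move=> e0; have [_ _ h] := hT.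
have : (limn_esup (fun n : nat =>
   ereal_sup [set (`|iter n T x - iter n T y| - `|x - y|)%:E
             | x in C & y in C]) < e%:E)%E by rewrite (le_lt_trans h)// lte_fin.
rewrite /limn_esup limf_esupE => /ereal_inf_lt[_ [W [N _ NW] <-]] hW.
exists N => n Nn x y Cx Cy; rewrite -lerBlDl -lee_fin.
apply: (le_trans _ (ltW hW)).
apply: (@le_trans _ _ (ereal_sup [set (`|iter n T x - iter n T y| - `|x - y|)%:E
             | x in C & y in C])).
  by apply: ereal_sup_ubound; exists x => //; exists y.
by apply: ereal_sup_ubound; exists n => //; exact: NW.
Qed.

Lemma intermediate_continuous x (e : R) : C x -> 0 < e -> exists2 d : R, 0 < d &
  forall z, C z -> `|x - z| < d -> `|T x - T z| < e.
Proof.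
have [_ /subspace_continuousP cT _] := hT => Cx e0.
move: (cT _ Cx) => /cvgrPdist_lt/(_ e e0); rewrite near_withinE.
move=> /nbhs_ballP[d /= d0 h]; exists d => // z Cz xz.
by apply: h => //; rewrite -ball_normE.
Qed.

Variable c : R.
Hypothesis c12 : 1 < c < 2.
Hypothesis Xnj : forall x y : X,
  `|x + y| ^+ 2 + `|x - y| ^+ 2 <= 2 * c * (`|x| ^+ 2 + `|y| ^+ 2).
Hypotheses (C_bounded : bounded_set C) (C_convex : convex_set C).

Let V : njSpace c := @NJSpace R c X (fun x => `|x|) (@ler_normD _ _)
  (fun a x => normrZ a x) Xnj.

(** Late iterates replace the single displacement |T y - y|, since only high powers of [T] are known
    to be nearly nonexpansive. *)
Definition almost_fixed (e : R) (y : X) :=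
  exists k0, forall k, (k0 <= k)%N -> `|iter k T y - y| <= e.

Section improve.
Variables (M : R) (y : X) (e : R).
Hypothesis CM : forall x, C x -> `|x| <= M.
Hypotheses (Cy : C y) (e0 : 0 < e) (ye : almost_fixed e y).

Let E : njSpace c := upow V.

(** Bounds limsup_k |T^k y - w n| by about [e] for almost every n. High powers of [T] preserve this
    condition, whereas a ball about [y] need not be preserved. *)
Let K : set E := fun w => (forall n, C (w n)) /\ forall d : R, 0 < d ->
  U (fun n => exists k0, forall k, (k0 <= k)%N -> `|iter k T y - w n| <= e + d).

Let domK : domain K M.
Proof.
have bd (w : E) : (forall n, C (w n)) -> nrm w <= M.
  by move=> Cw; apply: unrm_le; apply: U_all => n; exact: CM.
split.
- have yE n : mkU (V := V) (fun=> y) n = y :> V by apply: (mkUE (M := M)) => _; exact: CM.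
  exists (mkU (V := V) (fun=> y)); split=> [n|d d0]; first by rewrite yE.
  apply: U_all => n; have [k0 hk] := ye; exists k0 => k /hk h; rewrite yE.
  by rewrite (le_trans h)// lerDl ltW.
- move=> t w w' t01 [Cw hw] [Cw' hw'].
  have tE n : (t *: w + (1 - t) *: w' : E) n = t *: w n + (1 - t) *: w' n by [].
  have /andP[t0 t1] := t01; split=> [n|d d0].
    rewrite tE; apply/set_mem.
    exact: (C_convex (Itv01 t0 t1) (mem_set (Cw n)) (mem_set (Cw' n))).
  apply: U_mono (U_and (hw d d0) (hw' d d0)) => n [[k1 h1] [k2 h2]].
  exists (maxn k1 k2) => k; rewrite geq_max => /andP[/h1 {}h1 /h2 {}h2].
  rewrite tE distrC.
  apply: (le_trans (@nrm_convB _ _ V _ _ _ (iter k T y) t01)) => /=.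
  rewrite [`|w n - _|]distrC [`|w' n - _|]distrC; nra.
- move=> u Ku cu.
  have ub j n : nrm (u j n) <= M by apply: CM; exact: (Ku j).1.
  have [x hx ux] := upow_complete ub cu; exists x => //; split=> [n|d d0].
    by have [j ->] := hx n; exact: (Ku j).1.
  have d40 : 0 < d / 4 by rewrite divr_gt0.
  have [N /(_ N (leqnn N)) hN] := ux _ d40.
  have : nrm (u N - x) < d / 3 by lra.
  move=> /unrm_lt hU; apply: U_mono (U_and hU ((Ku N).2 _ d40)) => n [h1 [k0 h2]].
  exists k0 => k /h2 {}h2; have := @nrm_tri _ _ V (u N n) (iter k T y) (x n).
  move: h1; rewrite uvalD uvalN /=; lra.
- by move=> w [Cw _]; exact: bd.
Qed.

(** Along such [s] the error in [intermediate_eps] vanishes, which makes [S s] nonexpansive. All [s]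
    are taken at once so that [improve] can choose one after seeing the fixed point. *)
Let index := {s : nat -> nat | forall N, U (fun n => (N <= s n)%N)}.

Let S (s : index) (w : E) : E :=
  mkU (V := V) (fun n => iter (sval s n) T (w n)).

Let SE s w n : K w -> S s w n = iter (sval s n) T (w n).
Proof.
by move=> [Cw _]; apply: (mkUE (M := M)) => k; apply: CM; exact: intermediate_maps.
Qed.

Let famK : nonexp_family K S.
Proof.
split.
- move=> s w Kw; have [Cw hw] := Kw; split=> [n|d d0].
    by rewrite SE//; exact: intermediate_maps.
  have d20 : 0 < d / 2 by rewrite divr_gt0.
  have [N hN] := intermediate_eps d20.
  apply: U_mono (U_and (proj2_sig s N) (hw _ d20)) => n [Ns [k0 h]].
  exists (k0 + sval s n)%N => k hk; rewrite SE//.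
  have sk : (sval s n <= k)%N := leq_trans (leq_addl _ _) hk.
  rewrite -(subnKC sk) iterD.
  have := hN _ Ns _ _ (intermediate_maps (k - sval s n) Cy) (Cw n).
  have := h (k - sval s n)%N; rewrite leq_subRL// addnC => /(_ hk); lra.
- move=> s w w' Kw Kw'; have [Cw _] := Kw; have [Cw' _] := Kw'.
  apply/ler_addgt0Pr => d d0; apply: unrm_le.
  have d20 : 0 < d / 2 by rewrite divr_gt0.
  have [N hN] := intermediate_eps d20.
  have : nrm (w - w') < nrm (w - w') + d / 2 by rewrite ltrDl.
  move=> /unrm_lt hU; apply: U_mono (U_and (proj2_sig s N) hU) => n [Ns].
  rewrite !uvalD !uvalN !SE//= => h.
  have := hN _ Ns _ _ (Cw n) (Cw' n); lra.
- move=> s s' w Kw; have [Cw _] := Kw; rewrite {1}/S [RHS]/S; congr mkU.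
  by apply/funext => n; rewrite !SE// -!iterD addnC.
Qed.

(** The sequence [s] picks at each n a time k >= n that moves [w n] by more than [d], if there is
    one. Since [S s] fixes [w], almost every n has no such time. The factor 3 is 2 from membership
    in [K] with slack [e] and 1 from [ye]. *)
Lemma improve d : 0 < d -> exists z, [/\ C z, `|z - y| <= 3 * e & almost_fixed d z].
Proof.
move=> d0; have [w [Cw hw] Sw] := fpp_infinite c12 domK famK.
pose bad n k := (n <= k)%N /\ d < `|iter k T (w n) - w n|.
have bad_ex n : exists k, (n <= k)%N /\ ((exists k, bad n k) -> bad n k).
  have [[k hk]|h] := pselect (exists k, bad n k).
    by exists k; split => //; have [] := hk.
  by exists n.
have [s hs] := choice bad_ex.
have sU N : U (fun n => (N <= s n)%N).
  by apply: U_mono (U_ge N) => n Nn; rewrite (leq_trans Nn)//; exact: (hs n).1.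
have : nrm (S (exist _ s sU) w - w) < d by rewrite Sw.
move=> /unrm_lt h1; have [n [h2 [k1 h3]]] := U_ex (U_and h1 (hw e e0)).
rewrite uvalD uvalN SE//= in h2.
exists (w n); split=> //.
- have [k0 hk0] := ye; have := h3 (maxn k0 k1) (leq_maxr _ _).
  have := hk0 (maxn k0 k1) (leq_maxl _ _).
  have := @nrm_tri _ _ V (iter (maxn k0 k1) T y) (w n) y; rewrite /= [`|w n - iter _ _ _|]distrC.
  lra.
- exists n => k nk; rewrite leNgt; apply/negP => hk.
  have [_ /(_ (ex_intro _ k (conj nk hk)))[_]] := hs n.
  by rewrite ltNge (ltW h2).
Qed.

End improve.

Hypotheses (C_neq0 : C !=set0) (C_closed : closed C).

Lemma intermediate_fixed : exists2 x, C x & T x = x.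
Proof.
have [M M0 CM] : exists2 M : R, 0 < M & forall x, C x -> `|x| <= M.
  have [M M0 h] := pinfty_ex_gt0 C_bounded; by exists M => // x Cx; exact: h.
(* At n = 0 this is 2 M, so that any starting point of [C] is almost fixed. *)
pose e n : R := M * 2 * 2^-1 ^+ n.
have e0 n : 0 < e n by rewrite !mulr_gt0 ?exprn_gt0 ?invr_gt0.
have step p : exists z, C p.2 /\ almost_fixed (e p.1) p.2 ->
   [/\ C z, `|z - p.2| <= 3 * e p.1 & almost_fixed (e p.1.+1) z].
  have [[Cp hp]|h] := pselect (C p.2 /\ almost_fixed (e p.1) p.2); last by exists p.2.
  by have [z hz] := improve CM Cp (e0 _) hp (e0 p.1.+1); exists z.
have [g hg] := choice step.
have [y0 Cy0] := C_neq0.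
pose y := fix y n := if n is n'.+1 then g (n', y n') else y0.
have hy n : C (y n) /\ almost_fixed (e n) (y n).
  elim: n => [|n IH]; last by have [] := hg (n, y n) IH.
  split=> //; exists 0%N => k _; rewrite /e expr0 mulr1.
  have := ler_normB (iter k T y0) y0; have := CM _ Cy0.
  have := CM _ (intermediate_maps k Cy0); lra.
have dy n : `|y n.+1 - y n| <= 3 * e n by have [] := hg (n, y n) (hy n).
(* Telescoping, because 3 e_n = 6 (e_n - e_(n+1)). *)
have dist n m : `|y (n + m)%N - y n| <= 6 * (e n - e (n + m)%N).
  elim: m => [|m IH]; first by rewrite addn0 !subrr normr0 mulr0.
  have := @nrm_tri _ _ V (y (n + m)%N) (y (n + m).+1) (y n); have := dy (n + m)%N.
  by rewrite addnS (_ : e _.+1 = e (n + m)%N / 2) /=; [lra|rewrite /e exprS; field].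
have dist2 n m : (n <= m)%N -> `|y m - y n| <= 6 * e n.
  by move=> /subnKC <-; rewrite (le_trans (dist _ _))// ler_wpM2l// gerBl ltW.
have esmall d : 0 < d -> exists n, e n < d.
  move=> d0; have [n] := archi_inv (divr_gt0 d0 (mulr_gt0 M0 (ltr0Sn R 1))).
  rewrite ltr_pdivlMr ?mulr_gt0// mulrC => hn; exists n; apply: le_lt_trans hn.
  apply: ler_wpM2l; first by rewrite ltW ?mulr_gt0.
  rewrite exprVn lef_pV2 ?posrE ?exprn_gt0//.
  by rewrite -natrX ler_nat ltn_expl.
have [x yx] : exists x, forall d : R, 0 < d -> exists N, forall n, (N <= n)%N ->
    `|x - y n| <= d.
  have cy : cvg (y @ \oo).
    apply/cauchy_cvgP/cauchy_ballP => d d0; near_simpl.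
    have [N hN] := esmall (d / 13) (divr_gt0 d0 (ltr0Sn R 12)).
    exists ([set n | (N <= n)%N], [set n | (N <= n)%N]); first by split; exists N.
    move=> [p q] /= [Np Nq]; rewrite -ball_normE /=.
    have := @nrm_tri _ _ V (y N) (y p) (y q); have := dist2 _ _ Np.
    have := dist2 _ _ Nq; rewrite /= [`|y N - y q|]distrC; lra.
  exists (lim (y @ \oo)) => d d0.
  move/cvgrPdist_le: cy => /(_ d d0)[N _ hN].
  by exists N => n; exact: hN.
have Cx : C x.
  apply: C_closed => B /nbhs_ballP[d /= d0 hB]; have d20 : 0 < d / 2 by rewrite divr_gt0.
  have [N /(_ N (leqnn N)) hN] := yx _ d20.
  exists (y N); split; first exact: (hy N).1.
  by apply: hB; rewrite -ball_normE /=; lra.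
have xfix d : 0 < d -> exists N, forall k, (N <= k)%N -> `|iter k T x - x| <= d.
  move=> d0; have d40 : 0 < d / 4 by rewrite divr_gt0.
  have [N1 hN1] := yx _ d40; have [N2 hN2] := esmall _ d40.
  pose n := maxn N1 N2; have [Cy [k0 hk0]] := hy n.
  have en : e n < d / 4.
    apply: le_lt_trans hN2; apply: ler_wpM2l; first by rewrite ltW ?mulr_gt0.
    by rewrite !exprVn lef_pV2 ?posrE ?exprn_gt0// ler_eXn2l ?leq_maxr// ltr1n.
  have [N3 hN3] := intermediate_eps d40.
  exists (maxn k0 N3) => k; rewrite geq_max => /andP[/hk0 h1 /hN3/(_ _ _ Cx Cy) h2].
  have h3 := hN1 n (leq_maxl _ _).
  have := @nrm_tri _ _ V (iter k T (y n)) (iter k T x) x.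
  have := @nrm_tri _ _ V (y n) (iter k T (y n)) x.
  rewrite /= [`|y n - x|]distrC; lra.
exists x => //; apply/eqP; rewrite -subr_eq0 -normr_le0; apply/ler_addgt0Pr => d d0.
rewrite add0r; have d20 : 0 < d / 2 by rewrite divr_gt0.
(* For large k, T^(k+1) x is near T x by continuity at x, and also near x by [xfix]. *)
have [q q0 hq] := intermediate_continuous Cx d20.
have [N1 h1] := xfix _ (divr_gt0 q0 (ltr0Sn R 1)); have [N2 h2] := xfix _ d20.
pose k := maxn N1 N2.
have := h1 k (leq_maxl _ _); rewrite distrC => {}h1.
have := h2 k.+1 (leqW (leq_maxr _ _)) => /= {}h2.
have /(hq _ (intermediate_maps k Cx)) : `|x - iter k T x| < q by lra.
have := @nrm_tri _ _ V (T (iter k T x)) (T x) x; move: h2; rewrite /=; lra.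
Unshelve. all: by end_near.
Qed.

End intermediate.

Theorem corollary2p5 (R : realType) (X : completeNormedModType R)
    (hX : uniformly_nonsquare X) (C : set X)
    (C_neq0 : C !=set0) (C_bounded : bounded_set C) (C_closed : closed C)
    (C_convex : convex_set C) (T : X -> X)
    (hT : asymptotically_nonexpansive_intermediate C T) :
  exists2 x, C x & T x = x.
Proof.
have [c c12 cX] := nonsquare_nj hX.
exact: (intermediate_fixed hT c12 cX).
Qed.
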